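(* Let $p\in[1,\infty)$, and let $(X_i,d_i,e_i)_{i\in\mathbb N}$ be a sequence of pointed metric spaces with metric ultralimit $(\hat X,\hat d)$. Let $\mu^\omega\in\mathcal P_p(X)^\omega_{\lim}$, and suppose, in addition, that $\mu^\omega$ is supported within $B(e^\omega,D)=\{x\in X^\omega:d^\omega(e^\omega,x)<D\}$ for some $D\in\mathbb R$, that is, $\mu^\omega(X^\omega\setminus B(e^\omega,D))=0$. Let $\mu_L$ be the Loeb measure associated to $\mu^\omega$. Then, if the $st_{\hat d}$-pushforward of $\mu_L$ is well-defined and belongs to $\mathcal P_p(\hat X)$, it holds that $\mu^\omega$ is a $\hat W_p$-lifting of $\mu_L\circ st_{\hat d}^{-1}$.
   Context: Fix a non-principal ultrafilter $\omega$ on $\mathbb N$. A property holds $\omega$-a.s. if the set of indices for which it holds belongs to $\omega$. $X^\omega=\prod_i X_i/\sim_\omega$ is the ultraproduct, classes written $[(x_i)]$; $\mathbb R^\omega$ is the ultrapower of $\mathbb R$; $a\approx b$ means $|a-b|<\varepsilon$ for every standard real $\varepsilon>0$; $st(a)$ is the real $r$ with $a\approx r$ (if $a$ is finite). Metric ultralimit: $d^\omega([(x_i)],[(y_i)])=[(d_i(x_i,y_i))]$, $e^\omega=[(e_i)]$, $X^\omega_{\lim}=\{x\in X^\omega:d^\omega(e^\omega,x)\text{ is finite}\}$; $\hat X$ is the quotient of $X^\omega_{\lim}$ by $d^\omega(x,y)\approx0$, with metric $\hat d$ induced by $st(d^\omega)$ and quotient map $st_{\hat d}:X^\omega_{\lim}\to\hat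 X$. For a metric space $Y$, $\mathcal P_p(Y)$ is the set of Radon probability measures on $Y$ with finite $p$th moment, and $W_p(\mu,\nu)=\inf_{\gamma\in\Pi(\mu,\nu)}\left(\int d(x,y)^p\,d\gamma\right)^{1/p}$, with $\Pi(\mu,\nu)$ the couplings. $\mathcal P_p(X)^\omega$ is the ultraproduct of the $\mathcal P_p(X_i)$, $W_p^\omega([(\mu_i)],[(\nu_i)])=[(W_p(\mu_i,\nu_i))]$, and $\mathcal P_p(X)^\omega_{\lim}$ is the set of $[(\mu_i)]$ with $W_p^\omega([(\mu_i)],[(\delta_{e_i})])$ finite. $(\widehat{\mathcal P_p(X)},\hat W_p)$ is the metric ultralimit of $(\mathcal P_p(X_i),W_p,\delta_{e_i})$, with quotient map $st_{\hat W_p}:\mathcal P_p(X)^\omega_{\lim}\to\widehat{\mathcal P_p(X)}$. The map $\iota:\mathcal P_p(\hat X)\to\widehat{\mathcal P_p(X)}$ is the isometric embedding given, for $\hat x_j=st_{\hat d}[(x_{j,i})_i]$, by $\iota\left(\frac1N\sum_{j=1}^N\delta_{\hat x_j}\right)=st_{\hat W_p}\left[\left(\frac1N\sum_{j=1}^N\delta_{x_{j,i}}\right)_{i}\right]$ and extended to $\mathcal P_p(\hat X)$ by density. A ($\hat W_p$-)lifting of $\mu\in\mathcal P_p(\hat X)$ is a $\mu^\omega\in\mathcal P_p(X)^\omega_{\lim}$ with $st_{\hat W_p}(\mu^\omega)=\iota\mu$. Loeb measures: $\mathcal B^\omega$ is the algebra of internal Borel sets $B^\omega=[(B_i)]=\{[(x_i)]:x_i\in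 B_i\ \omega\text{-a.s.}\}$, $B_i\subseteq X_i$ Borel. For an internal probability measure $\mu^\omega=[(\mu_i)]$ put $\mu^\omega(B^\omega)=[(\mu_i(B_i))]$. Then $st\circ\mu^\omega$ is a premeasure on $\mathcal B^\omega$, and its (complete) Carathéodory extension $\mu_L=\mathrm{Loeb}(\mu^\omega)$ is the Loeb measure associated to $\mu^\omega$. The pushforward $\mu_L\circ st_{\hat d}^{-1}$ is well-defined when $st_{\hat d}^{-1}(B)$ is $\mu_L$-measurable for every Borel $B\subseteq\hat X$. *)

(* Defs.v *)
From HB Require Import structures.
From mathcomp Require Import all_boot all_order all_algebra.
From mathcomp Require Import all_classical all_reals all_analysis.
From mathcomp Require Import measurable_realfun lra.

Set Implicit Arguments.
Unset Strict Implicit.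
Unset Printing Implicit Defensive.

Import Order.TTheory GRing.Theory Num.Theory.
Import numFieldNormedType.Exports.

Local Open Scope classical_set_scope.
Local Open Scope ring_scope.

(* A pointed metric space (Y, mdist, point). *)
#[short(type="pmetricType")]
HB.structure Definition PointedMetric (R : numDomainType) :=
  {T of Pointed T & Metric R T}.

Record npultrafilter := NPUltrafilter {
  ufilter :> set nat -> Prop ;
  ufilter_ultra : UltraFilter ufilter ;
  ufilter_nonprincipal : forall n, ~ ufilter [set n]%classic }.
#[global] Existing Instance ufilter_ultra.

Section ultraproduct.
Variables (omega : npultrafilter) (T : nat -> Type).

Definition ultra_eq : rel {classic forall i, T i} := fun x y =>
  `[< omega [set i | x i = y i] >].

Lemma ultra_eq_refl : reflexive ultra_eq.
Proof. by move=> x; apply/asboolP; apply: filterE. Qed.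

Lemma ultra_eq_sym : symmetric ultra_eq.
Proof.
by move=> x y; apply/asboolP/asboolP; apply: filterS => i /= ->.
Qed.

Lemma ultra_eq_trans : transitive ultra_eq.
Proof.
move=> y x z /asboolP xy /asboolP yz; apply/asboolP.
by apply: filterS2 xy yz => i /= -> ->.
Qed.

Canonical ultra_equiv :=
  EquivRel ultra_eq ultra_eq_refl ultra_eq_sym ultra_eq_trans.

Definition ultraprod := {eq_quot ultra_equiv}%qT.

Definition uclass (x : forall i, T i) : ultraprod := (\pi_ultraprod x)%qT.

Definition urepr (a : ultraprod) : forall i, T i := repr a.

Lemma uclassP (x y : forall i, T i) :
  uclass x = uclass y <-> omega [set i | x i = y i].
Proof.
split; first by move=> /eqquotP/asboolP.
by move=> xy; apply/eqquotP/asboolP.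
Qed.

Lemma ureprK (a : ultraprod) : uclass (urepr a) = a.
Proof. exact: reprK. Qed.

Lemma urepr_uclass (x : forall i, T i) :
  omega [set i | urepr (uclass x) i = x i].
Proof. by apply/uclassP; rewrite ureprK. Qed.

End ultraproduct.

Section internal_operation.
Variables (omega : npultrafilter) (S T U : nat -> Type).

(* The internal operation ([(x_i)], [(y_i)]) |-> [(f_i(x_i, y_i))]. *)
Definition umap2 (f : forall i, S i -> T i -> U i)
    (a : ultraprod omega S) (b : ultraprod omega T) : ultraprod omega U :=
  uclass omega (fun i => f i (urepr a i) (urepr b i)).

Lemma umap2E f (x : forall i, S i) (y : forall i, T i) :
  umap2 f (uclass omega x) (uclass omega y) =
  uclass omega (fun i => f i (x i) (y i)).
Proof.
apply/uclassP; apply: filterS2 (urepr_uclass omega x) (urepr_uclass omega y).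
by move=> i /= -> ->.
Qed.

End internal_operation.

Section hyperreal.
Variables (omega : npultrafilter) (R : realType).

Definition hyperreal := ultraprod omega (fun=> R).

Definition hstd (r : R) : hyperreal := uclass omega (fun=> r).

Definition hlt (a b : hyperreal) : Prop :=
  omega [set i | urepr a i < urepr b i].

Definition hdist : hyperreal -> hyperreal -> hyperreal :=
  umap2 (fun (_ : nat) (a b : R) => `|a - b|).

Definition happrox (a b : hyperreal) : Prop :=
  forall eps : R, 0 < eps -> hlt (hdist a b) (hstd eps).

Definition hfinite (a : hyperreal) : Prop :=
  exists r : R, hlt (hdist a (hstd 0)) (hstd r).

(* Standard part; junk value 0 off the finite hyperreals. *)
Definition hst (a : hyperreal) : R := xget 0 [set r | happrox a (hstd r)].

Lemma hltE (a b : nat -> R) :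
  hlt (uclass omega a) (uclass omega b) <-> omega [set i | a i < b i].
Proof.
have ra := urepr_uclass omega a; have rb := urepr_uclass omega b.
split=> h; last by apply: filterS3 ra rb h => i /= -> ->.
by apply: filterS3 ra rb h => i /= <- <-.
Qed.

Lemma happroxE (a b : nat -> R) :
  happrox (uclass omega a) (uclass omega b) <->
  forall eps, 0 < eps -> omega [set i | `|a i - b i| < eps].
Proof.
by split=> h eps /h; rewrite /hdist umap2E /hstd => /hltE.
Qed.

Lemma hfiniteE (a : nat -> R) :
  hfinite (uclass omega a) <-> exists r, omega [set i | `|a i| < r].
Proof.
split=> -[r h]; exists r; move: h; rewrite /hdist umap2E /hstd.
  by move=> /hltE; apply: filterS => i /=; rewrite subr0.
by move=> h; apply/hltE; apply: filterS h => i /=; rewrite subr0.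
Qed.

Lemma hfinite_st (a : nat -> R) : hfinite (uclass omega a) ->
  happrox (uclass omega a) (hstd (hst (uclass omega a))).
Proof.
move=> /hfiniteE[r ar].
suff ex : exists s, happrox (uclass omega a) (hstd s).
  by rewrite /hst; exact: (@xgetPex R 0 _ ex).
pose S := [set s : R | omega [set i | s < a i]].
have S0 : S !=set0.
  exists (- r); apply: filterS ar => i /=.
  by rewrite ltr_norml => /andP[].
have Sr : ubound S r.
  move=> s /= Ss.
  have [i /= [si]] := filter_ex (filterI Ss ar).
  by rewrite ltr_norml => /andP[_ ir]; rewrite (ltW (lt_trans si ir)).
have Ssup : has_sup S by split => //; exists r.
exists (sup S); apply/happroxE => eps eps0.
have [s Ss sS] := sup_adherent eps0 Ssup.
have nS : ~ S (sup S + eps / 2).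
  move=> /(sup_upper_bound Ssup).
  by rewrite gerDl leNgt divr_gt0.
have nS' : omega [set i | a i <= sup S + eps / 2].
  have [//|] := in_ultra_setVsetC [set i | sup S + eps / 2 < a i] (ufilter_ultra omega).
  by apply: filterS => i /= /negP; rewrite -leNgt.
apply: filterS2 Ss nS' => i /= si iS.
rewrite ltr_norml; apply/andP; split; first lra.
by apply: le_lt_trans (_ : eps / 2 < eps); lra.
Qed.

End hyperreal.

Section metric_ultralimit.
Variables (omega : npultrafilter) (R : realType) (T : nat -> Type).
Variables (d : forall i, T i -> T i -> R) (e : forall i, T i).

Definition udist : ultraprod omega T -> ultraprod omega T -> hyperreal omega R :=
  umap2 d.

Definition ulim : Type :=
  {x : ultraprod omega T | hfinite (udist (uclass omega e) x)}.

(* The quotient by d^omega ~ 0 is realised by the set of its classes, so that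
   it can be formed before d is known to satisfy the metric axioms. *)
Definition hat_class (x : ulim) : set ulim :=
  [set y | happrox (udist (sval x) (sval y)) (hstd omega 0)].

Definition hat : Type := {A : set ulim | exists x, A = hat_class x}.

Definition st_hat (x : ulim) : hat :=
  exist (fun A => exists x, A = hat_class x) (hat_class x)
        (ex_intro (fun y => hat_class x = hat_class y) x erefl).

Definition hat_repr (a : hat) : ulim := sval (cid (svalP a)).

Definition hat_dist (a b : hat) : R :=
  hst (udist (sval (hat_repr a)) (sval (hat_repr b))).

Lemma hat_reprK (a : hat) : st_hat (hat_repr a) = a.
Proof.
case: a => A hA; apply: eq_exist; rewrite /hat_repr.
by case: (cid _) => x /= ->.
Qed.

End metric_ultralimit.

Section hatX.
Variables (R : realType) (omega : npultrafilter) (X : nat -> pmetricType R).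

Let dX i := @mdist R (X i).
Let eX i : X i := point.

Definition Xomega : Type := ultraprod omega (fun i => X i).
Definition Xlim : Type := ulim omega dX eX.
Definition hatX : Type := hat omega dX eX.

Lemma Xlim_center : hfinite (udist dX (uclass omega eX) (uclass omega eX)).
Proof.
rewrite /udist umap2E; apply/hfiniteE; exists 1; apply: filterE => i /=.
by rewrite /dX mdistxx normr0.
Qed.

Lemma Xlim_dist (x y : Xlim) : hfinite (udist dX (sval x) (sval y)).
Proof.
case: x y => [x hx] [y hy] /=; move: hx hy.
rewrite -(ureprK x) -(ureprK y) /udist !umap2E => /hfiniteE[r hr] /hfiniteE[s hs].
apply/hfiniteE; exists (r + s); apply: filterS2 hr hs => i /=.
rewrite /dX !ger0_norm ?mdist_ge0// => hr hs.
apply: le_lt_trans (metric_triangle _ (eX i) _) _.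
by rewrite metric_sym ltrD.
Qed.

Definition hatd (a b : hatX) : R := hat_dist a b.

Lemma hatd_approx (a b : hatX) eps : 0 < eps -> omega [set i |
  `|dX (urepr (sval (hat_repr a)) i) (urepr (sval (hat_repr b)) i) - hatd a b|
    < eps].
Proof.
have := Xlim_dist (hat_repr a) (hat_repr b).
by move=> /hfinite_st /happroxE; exact.
Qed.

Lemma hatdxx a : hatd a a = 0.
Proof.
apply/eqP/contraT => h; rewrite -normr_gt0 in h.
have [i /=] := filter_ex (hatd_approx a a h).
by rewrite /dX mdistxx sub0r normrN ltxx.
Qed.

Lemma hatd_sym a b : hatd a b = hatd b a.
Proof.
congr hst; congr uclass; apply/funext => i; exact: metric_sym.
Qed.

Lemma hatd_triangle b a c : hatd a c <= hatd a b + hatd b c.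
Proof.
apply/ler_addgt0Pl => eps eps0; have e3 : 0 < eps / 3 by rewrite divr_gt0.
have := filter_ex (filterI (hatd_approx a b e3)
  (filterI (hatd_approx b c e3) (hatd_approx a c e3))).
move=> -[i /=]; rewrite /dX.
set xa := urepr _ _; set xb := urepr _ _; set xc := urepr _ _.
have := metric_triangle xa xb xc; rewrite !ltr_norml.
by move=> ? [/andP[? ?] [/andP[? ?] /andP[? ?]]]; lra.
Qed.

Lemma hatd_positivity a b : hatd a b = 0 -> a = b.
Proof.
move=> ab0; have ab eps : 0 < eps -> omega [set i |
    dX (urepr (sval (hat_repr a)) i) (urepr (sval (hat_repr b)) i) < eps].
  move=> /(hatd_approx a b); rewrite ab0; apply: filterS => i /=.
  by rewrite subr0 ger0_norm// mdist_ge0.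
rewrite -(hat_reprK a) -(hat_reprK b); apply: eq_exist.
apply/seteqP; split => z /=; rewrite /hat_class /=.
- move=> /happroxE h; apply/happroxE => eps eps0.
  have e2 : 0 < eps / 2 by rewrite divr_gt0.
  apply: filterS2 (h _ e2) (ab _ e2) => i /=.
  rewrite !subr0 !ger0_norm ?mdist_ge0// /dX => h1 h2.
  apply: le_lt_trans (metric_triangle _ (urepr (sval (hat_repr a)) i) _) _.
  by rewrite metric_sym [ltRHS]splitr ltrD.
- move=> /happroxE h; apply/happroxE => eps eps0.
  have e2 : 0 < eps / 2 by rewrite divr_gt0.
  apply: filterS2 (h _ e2) (ab _ e2) => i /=.
  rewrite !subr0 !ger0_norm ?mdist_ge0// /dX => h1 h2.
  apply: le_lt_trans (metric_triangle _ (urepr (sval (hat_repr b)) i) _) _.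
  by rewrite [ltRHS]splitr ltrD.
Qed.

HB.instance Definition _ := gen_eqMixin hatX.
HB.instance Definition _ := gen_choiceMixin hatX.
HB.instance Definition _ :=
  isPointed.Build hatX (st_hat (exist _ (uclass omega eX) Xlim_center)).
HB.instance Definition _ :=
  @isMetric.Build R hatX hatd hatdxx hatd_positivity hatd_sym hatd_triangle.

Definition stX (x : Xlim) : hatX := st_hat x.

(* The full inverse image st^{-1}(B), as a subset of X^omega. *)
Definition stX_preimage (B : set hatX) : set Xomega :=
  [set sval x | x in stX @^-1` B].

Definition uball (D : R) : set Xomega :=
  [set x | hlt (udist dX (uclass omega eX) x) (hstd omega D)].

End hatX.

(* The Borel sigma-algebra of a topological space Y. *)
Notation borel Y := (g_sigma_algebraType (@open Y)).

(* The empirical measure of the N + 1 points x 0, ..., x N. *)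
Section empirical.
Local Open Scope ereal_scope.
Context d (T : measurableType d) (R : realType) (N : nat) (x : nat -> T).

Definition empirical : set T -> \bar R :=
  mscale ((N.+1%:R)^-1)%:nng%R (msum (fun j => \d_(x j)) N.+1).

HB.instance Definition _ := Measure.on empirical.

Lemma empiricalE A :
  empirical A = ((N.+1%:R)^-1)%R%:E * \sum_(j < N.+1) \d_(x j) A.
Proof. by []. Qed.

Lemma empiricalT : empirical setT = 1.
Proof.
rewrite empiricalE (eq_bigr (fun=> 1%:E)); last by move=> j _; rewrite diracT.
rewrite sumEFin big_const_ord iter_addr_0 -EFinM.
by rewrite mulVf// pnatr_eq0.
Qed.

HB.instance Definition _ :=
  Measure_isProbability.Build _ _ _ empirical empiricalT.

Lemma integral_empirical (f : T -> \bar R) : measurable_fun setT f ->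
  (forall y, 0 <= f y) ->
  \int[empirical]_y f y = ((N.+1%:R)^-1)%R%:E * \sum_(j < N.+1) f (x j).
Proof.
move=> mf f0; rewrite ge0_integral_mscale// ge0_integral_measure_sum//.
congr (_ * _); apply: eq_bigr => j _.
by rewrite integral_dirac// diracT mul1e.
Qed.

End empirical.


Section borel_measurability.
Variable R : realType.

Lemma measurable_open_ray (T : pointedType) (G : set (set T))
    (f : g_sigma_algebraType G -> R) :
  (forall a, G (f @^-1` `]a, +oo[)) -> measurable_fun setT f.
Proof.
move=> Gf; apply: (measurability _ (RGenOInfty.measurableE R)).
move=> _ [_ [a ->] <-]; rewrite setTI; apply: sub_sigma_algebra; exact: Gf.
Qed.

Lemma measurable_mdist2 (Y : pmetricType R) :
  measurable_fun setT (fun z : borel (Y * Y)%type =>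
    mdist (z : Y * Y).1 (z : Y * Y).2).
Proof.
apply: measurable_open_ray => a; rewrite openE => -[x y] /=.
rewrite /= in_itv/= andbT => axy.
have e0 : 0 < (mdist x y - a) / 2 by rewrite divr_gt0// subr_gt0.
exists (ball x ((mdist x y - a) / 2), ball y ((mdist x y - a) / 2)).
  by split; apply: nbhsx_ballx.
move=> [x' y'] /=; rewrite !ballEmdist /= => -[xx' yy'].
rewrite in_itv/= andbT.
have := metric_triangle x x' y; have := metric_triangle x' y' y.
by rewrite (metric_sym y' y); lra.
Qed.

Lemma measurable_mdist1 (Y : pmetricType R) (x0 : Y) :
  measurable_fun setT (fun x : borel Y => mdist x0 (x : Y)).
Proof.
apply: measurable_open_ray => a; rewrite openE => x /=.
rewrite /= in_itv/= andbT => ax; apply/nbhs_ballP.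
exists (mdist x0 x - a); first by rewrite /= subr_gt0.
move=> x' /=; rewrite ballEmdist /= in_itv/= andbT => xx'.
by have := metric_triangle x0 x' x; rewrite (metric_sym x' x); lra.
Qed.

Lemma measurable_powEFin d (T : measurableType d) (f : T -> R) (p : R) :
  measurable_fun setT f -> measurable_fun setT (fun x => ((f x) `^ p)%:E).
Proof.
move=> mf; apply/measurable_EFinP.
exact: (measurableT_comp (measurable_powR p) mf).
Qed.

Lemma compact_borel (Y : pmetricType R) (K : set Y) :
  compact K -> measurable (K : set (borel Y)).
Proof.
move=> /(compact_closed (@metric_hausdorff R Y)) cK.
rewrite -(setCK K); apply: measurableC; apply: sub_sigma_algebra.
exact: closed_openC.
Qed.

End borel_measurability.
Section wasserstein.
Variables (R : realType) (p : R) (Y : pmetricType R).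

Definition radon (mu : probability (borel Y) R) : Prop :=
  forall B : set (borel Y), measurable B ->
    mu B = ereal_sup [set mu K | K in [set K : set Y | compact K /\ K `<=` B]].

Definition finite_moment (mu : probability (borel Y) R) : Prop :=
  exists x0 : Y, (\int[mu]_x ((mdist x0 (x : Y)) `^ p)%:E < +oo)%E.

Definition Pp : Type :=
  {mu : probability (borel Y) R | radon mu /\ finite_moment mu}.

(* Couplings live on the Borel sets of the product space, which may be more
   than the product of the Borel sigma-algebras; only there is the distance
   always measurable.  With Radon marginals such a measure is itself Radon. *)
Definition coupling (mu nu : probability (borel Y) R) :
    set (probability (borel (Y * Y)%type) R) :=
  [set gamma | forall B : set (borel Y), measurable B ->
    gamma (fst @^-1` B) = mu B /\ gamma (snd @^-1` B) = nu B].

Definition cost (gamma : probability (borel (Y * Y)%type) R) : \bar R :=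
  \int[gamma]_z ((mdist (z : Y * Y).1 (z : Y * Y).2) `^ p)%:E.

(* The infimum is a real number, since mu and nu have finite p-th moment. *)
Definition Wp (mu nu : Pp) : R :=
  fine (ereal_inf
    [set (cost gamma `^ p^-1)%E | gamma in coupling (sval mu) (sval nu)]).

Lemma Wp_ge0 (mu nu : Pp) : 0 <= Wp mu nu.
Proof.
by apply/fine_ge0/le_ereal_inf_tmp => _ [gamma _ <-]; exact: poweR_ge0.
Qed.

Lemma Wp_le (mu nu : Pp) gamma (c : R) :
  coupling (sval mu) (sval nu) gamma -> cost gamma = c%:E ->
  Wp mu nu <= c `^ p^-1.
Proof.
move=> gP gc; have le_c : (ereal_inf [set (cost gamma `^ p^-1)%E |
    gamma in coupling (sval mu) (sval nu)] <= (c `^ p^-1)%:E)%E.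
  by apply: ereal_inf_lbound; exists gamma => //; rewrite gc.
rewrite -lee_fin; apply: le_trans (le_c); rewrite fineK//.
suff W0 : (0 <= ereal_inf [set (cost gamma `^ p^-1)%E |
    gamma in coupling (sval mu) (sval nu)])%E.
  by rewrite ge0_fin_numE// (le_lt_trans le_c)// ltry.
by apply: le_ereal_inf_tmp => _ [g _ <-]; exact: poweR_ge0.
Qed.

Lemma radon_finite_support (mu : probability (borel Y) R) (F : set Y) :
  finite_set F ->
  (forall B : set (borel Y), measurable B -> mu B = mu (B `&` F)) -> radon mu.
Proof.
move=> finF muF B mB; apply/eqP; rewrite eq_le; apply/andP; split.
  rewrite muF//; apply: ereal_sup_ubound; exists (B `&` F) => //.
  by split; [apply/finite_compact/finite_setIr|exact: subIsetl].
apply: ge_ereal_sup => _ [K [cK KB] <-].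
by apply: le_measure => //; rewrite inE//; exact: compact_borel.
Qed.

Lemma dirac_Pp_subproof (y : Y) :
  let mu : probability (borel Y) R := \d_(y : borel Y) in
  radon mu /\ finite_moment mu.
Proof.
split.
  apply: (radon_finite_support (finite_set1 y)) => B mB /=.
  by rewrite !diracE in_setI [in X in _ && X]mem_set// andbT.
exists y; rewrite integral_dirac//=; last first.
  apply: measurable_powEFin; exact: measurable_mdist1.
by rewrite diracT mul1e ltry.
Qed.

Definition dirac_Pp (y : Y) : Pp := exist _ _ (dirac_Pp_subproof y).

Lemma empirical_Pp_subproof N (x : nat -> Y) :
  let mu : probability (borel Y) R := empirical R N (x : nat -> borel Y) in
  radon mu /\ finite_moment mu.
Proof.
split.
  apply: (@radon_finite_support _ (x @` `I_N.+1)).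
    exact/finite_image/finite_II.
  move=> B mB /=; rewrite !empiricalE; congr (_ * _)%E.
  apply: eq_bigr => j _; rewrite !diracE in_setI.
  rewrite [X in _ && X](_ : _ = true) ?andbT//.
  by apply/mem_set; exists j => //=.
exists point; rewrite integral_empirical//=.
- by rewrite sumEFin -EFinM ltry.
- apply: measurable_powEFin; exact: measurable_mdist1.
- by move=> z; rewrite lee_fin powR_ge0.
Qed.

Definition empirical_Pp N (x : nat -> Y) : Pp :=
  exist _ _ (empirical_Pp_subproof N x).

Lemma Wp_dirac_dirac (y : Y) :
  Wp (dirac_Pp y) (dirac_Pp y) <= (0 `^ p) `^ p^-1.
Proof.
apply: (@Wp_le _ _ (\d_((y, y) : borel (Y * Y)%type))).
  by move=> B mB.
rewrite /cost integral_dirac//=; last first.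
  apply: measurable_powEFin; exact: measurable_mdist2.
by rewrite diracT mul1e mdistxx.
Qed.

Lemma Wp_dirac_empirical (y : Y) N (x : nat -> Y) :
  Wp (dirac_Pp y) (empirical_Pp N x) <=
  (N.+1%:R^-1 * \sum_(j < N.+1) (mdist y (x j)) `^ p) `^ p^-1.
Proof.
apply: (@Wp_le _ _
  (empirical R N (fun j => (y, x j) : borel (Y * Y)%type))).
  move=> B mB; split=> /=; rewrite !empiricalE; last by [].
  rewrite (eq_bigr (fun=> \d_(y : borel Y) B))//.
  have -> : \d_(y : borel Y) B = ((y \in B)%:R : R)%:E by rewrite diracE.
  rewrite sumEFin -EFinM big_const_ord iter_addr_0 -[X in _ * X]mulr_natl.
  by rewrite mulrA mulVf ?mul1r// pnatr_eq0.
rewrite /cost integral_empirical//=.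
- by rewrite sumEFin -EFinM.
- apply: measurable_powEFin; exact: measurable_mdist2.
- by move=> z; rewrite lee_fin powR_ge0.
Qed.

End wasserstein.

Section wasserstein_ultralimit.
Variables (R : realType) (omega : npultrafilter) (p : R).
Variable X : nat -> pmetricType R.

Let dW i := @Wp R p (X i).
Let eW i : Pp p (X i) := dirac_Pp p point.

Definition Pomega : Type := ultraprod omega (fun i => Pp p (X i)).
Definition Plim : Type := ulim omega dW eW.
Definition hatP : Type := hat omega dW eW.

HB.instance Definition _ := gen_eqMixin hatP.
HB.instance Definition _ := gen_choiceMixin hatP.

Definition stW (mu : Plim) : hatP := st_hat mu.

Lemma Plim_center : hfinite (udist dW (uclass omega eW) (uclass omega eW)).
Proof.
rewrite /udist umap2E; apply/hfiniteE; exists ((0 `^ p) `^ p^-1 + 1).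
apply: filterE => i /=; rewrite ger0_norm ?Wp_ge0//.
by rewrite (le_lt_trans (Wp_dirac_dirac p point))// ltrDl.
Qed.

(* [(1/(N+1) \sum_(j <= N) \delta_{x_{j,i}})_i], where x_j = [(x_{j,i})_i] *)
Definition empirical_omega N (x : nat -> Xlim omega X) : Pomega :=
  uclass omega
    (fun i => empirical_Pp p N (fun j => urepr (sval (x j)) i)).

Lemma empirical_omega_lim (hp : 1 <= p) N (x : nat -> Xlim omega X) :
  hfinite (udist dW (uclass omega eW) (empirical_omega N x)).
Proof.
have p0 : 0 <= p by apply: le_trans hp.
have bnd (j : nat) : exists r : R, omega [set i |
    mdist (point : X i) (urepr (sval (x j)) i) < r].
  case: (x j) => y hy /=; move: hy; rewrite -{1}(ureprK y) /udist umap2E.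
  move=> /hfiniteE[r hr]; exists r; apply: filterS hr => i /=.
  by rewrite ger0_norm// mdist_ge0.
have [r hr] := choice bnd.
rewrite /udist umap2E; apply/hfiniteE.
exists ((N.+1%:R^-1 * \sum_(j < N.+1) `|r j| `^ p) `^ p^-1 + 1).
have hrN : omega [set i | forall j : 'I_N.+1,
    mdist (point : X i) (urepr (sval (x j)) i) < r j].
  by apply: (@filter_forall _ _ (fun (j : 'I_N.+1) i =>
    mdist (point : X i) (urepr (sval (x j)) i) < r j)) => j; exact: hr.
apply: filterS hrN => i /= ri; rewrite ger0_norm ?Wp_ge0//.
apply: le_lt_trans (Wp_dirac_empirical _ _ _ _) _.
apply: (@le_lt_trans _ _ ((N.+1%:R^-1 * \sum_(j < N.+1) `|r j| `^ p) `^ p^-1));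
  last by rewrite ltrDl.
apply: ge0_ler_powR; rewrite ?nnegrE ?invr_ge0//.
- by rewrite mulr_ge0 ?invr_ge0// sumr_ge0// => j _; exact: powR_ge0.
- by rewrite mulr_ge0 ?invr_ge0// sumr_ge0// => j _; exact: powR_ge0.
- rewrite ler_wpM2l ?invr_ge0//; apply: ler_sum => j _.
  apply: ge0_ler_powR; rewrite ?nnegrE ?mdist_ge0//.
  exact: le_trans (ltW (ri j)) (ler_norm _).
Qed.

Definition iota_empirical (hp : 1 <= p) N (x : nat -> Xlim omega X) : hatP :=
  stW (exist _ (empirical_omega N x) (empirical_omega_lim hp N x)).

(* The extension of iota_empirical by density: the value at rho is the limit of
   the values at empirical measures converging to rho.  The first argument of
   xget is a junk value, returned if there were no such limit. *)
Definition iota (hp : 1 <= p) (rho : Pp p (hatX omega X)) : hatP :=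
  xget (stW (exist _ (uclass omega eW) Plim_center))
    [set a | forall eps : R, 0 < eps ->
      exists (N : nat) (x : nat -> Xlim omega X),
        Wp rho (empirical_Pp p N (fun j => stX (x j))) < eps /\
        hat_dist a (iota_empirical hp N x) < eps].

Definition is_lifting (hp : 1 <= p) (mu : Plim) (rho : Pp p (hatX omega X)) :=
  stW mu = iota hp rho.

End wasserstein_ultralimit.

Section loeb.
Variables (R : realType) (omega : npultrafilter) (X : nat -> pmetricType R).

Definition internal (B : forall i, set (X i)) : set (Xomega omega X) :=
  [set x | omega [set i | B i (urepr x i)]].

Definition borel_family (B : forall i, set (X i)) : Prop :=
  forall i, measurable (B i : set (borel (X i))).

Definition internal_borel : set (set (Xomega omega X)) :=
  [set internal B | B in borel_family].

Lemma internal_borel0 : internal_borel set0.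
Proof.
exists (fun i => set0); first by move=> i; exact: measurable0.
by apply/seteqP; split => x //= /filter_ex[].
Qed.

Lemma internal_borelU : setU_closed internal_borel.
Proof.
move=> _ _ [A mA <-] [B mB <-]; exists (fun i => A i `|` B i).
  by move=> i; exact: measurableU (mA i) (mB i).
apply/seteqP; split => x /=; last first.
  by case; apply: filterS => i /= ?; [left|right].
move=> AB.
have [|nA] :=
  in_ultra_setVsetC [set i | A i (urepr x i)] (ufilter_ultra omega).
  by left.
by right; apply: filterS2 AB nA => i /= [].
Qed.

Lemma internal_borelC : setC_closed internal_borel.
Proof.
move=> _ [A mA <-]; exists (fun i => ~` A i).
  by move=> i; exact: measurableC (mA i).
apply/seteqP; split => x /=.
  by move=> nA hA; have [i []] := filter_ex (filterI nA hA).
have [//|//] :=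
  in_ultra_setVsetC [set i | A i (urepr x i)] (ufilter_ultra omega).
Qed.

Definition internal_display : measure_display.
Proof. exact: (sigma_display internal_borel). Qed.

HB.instance Definition _ := gen_eqMixin (Xomega omega X).
HB.instance Definition _ := gen_choiceMixin (Xomega omega X).
HB.instance Definition _ :=
  isPointed.Build (Xomega omega X) (uclass omega (fun i => point)).
HB.instance Definition _ :=
  @isAlgebraOfSets.Build internal_display (Xomega omega X) internal_borel
    internal_borel0 internal_borelU internal_borelC.

Variables (p : R) (mu : Pomega omega p X).

(* mu^omega(B^omega) = [(mu_i(B_i))] for any Borel B_i with B^omega = [(B_i)];
   the result is independent of the B_i chosen here. *)
Definition internal_measure (A : set (Xomega omega X)) : hyperreal omega R :=
  let B := xget (fun i => set0)
    [set B | borel_family B /\ internal B = A] in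
  umap2 (fun i (m : Pp p (X i)) (Bi : set (X i)) => fine (sval m Bi))
    mu (uclass omega B).

Definition loeb_premeasure (A : set (Xomega omega X)) : \bar R :=
  (hst (internal_measure A))%:E.

Definition loeb : set (Xomega omega X) -> \bar R := mu_ext loeb_premeasure.

Definition loeb_measurable : set (set (Xomega omega X)) :=
  caratheodory_measurable loeb.

Definition loeb_push_defined : Prop :=
  forall B : set (borel (hatX omega X)), measurable B ->
    loeb_measurable (stX_preimage B).

Definition loeb_push (B : set (hatX omega X)) : \bar R :=
  loeb (stX_preimage B).

End loeb.

(* Main.v *)
From HB Require Import structures.
Require Import Defs.
From mathcomp Require Import all_boot all_order all_algebra.
From mathcomp Require Import all_classical all_reals all_analysis.
From mathcomp Require Import measurable_realfun ring lra.
From mathcomp Require finmap.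

(** Why the theorem holds.

    [iota] sends [rho] to the only point of the ultralimit that is approached by
    the standard parts of those empirical measures whose counterparts in the
    limit space approach [rho] ([iota_eq]).  So it suffices to find, for each
    [eps], finitely many elements of [Xlim omega X] such that the empirical
    measure on their images in the limit space is [eps]-close to [rho] and, for
    almost all [i], the one on their representatives in [X i] is [eps]-close to
    the component [mu i] of the given internal measure.

    To find it ([ex_empirical_near]), cover all but a small part of [rho], which
    is Radon, by finitely many balls of small radius [r] with centres [x j].
    The corresponding balls of the factors cut the ultraproduct into internal
    cells [V j] lying within [r] of [x j], and a remaining cell [V 0].  The Loeb
    measure [w j] of [V j] is the ultralimit of the masses of the [j]-th cells of
    the factors, and it is also the mass of the image in the limit space of the
    Loeb measure restricted to [V j] ([loeb_cells]).  Hence [rho] and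
    [mu i] are sums of pieces with nearly the same masses [w j], the [j]-th
    piece lying within [r] of [x j] and all of them within [D] of the base point.
    Round [w j] down to a multiple of [1 / (N + 1)] and collect the excess at the
    base point ([ex_labels]).  Transport to the resulting empirical measure costs
    at most [r `^ p] for the retained mass and [d * D `^ p] for an excess of mass
    at most [d] ([Wp_le_cells]); the bounded support is what controls the second
    term.

    Working in the ultralimit of the Wasserstein spaces requires the triangle
    inequality, whose usual proof glues couplings by disintegration.  Here one
    of the three measures can always be taken empirical, and then gluing is
    elementary.  A coupling of [nu] with an empirical measure on
    [x 0, ..., x N] amounts to writing [nu] as an average of probability
    measures, the [j]-th being transported to [x j] ([coupling_of_split],
    [split_of_coupling]).  Two splittings over the same points are glued by
    independent products of their pieces ([coupling_of_splits]); a splitting is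
    pushed along a coupling by the Radon-Nikodym densities of its pieces
    ([split_trans]).  In both cases Minkowski's inequality takes the form of a
    pointwise convexity inequality with constants fixed in advance
    ([powR_triangle]), to be integrated term by term.  Uniqueness of the limit
    also uses that the distance between two empirical measures depends on
    finitely many distances between points, and so passes from the limit space
    to almost all factors ([empirical_transfer]). *)

Set Implicit Arguments.
Unset Strict Implicit.
Unset Printing Implicit Defensive.

Import Order.TTheory GRing.Theory Num.Theory.
Import numFieldNormedType.Exports.

Local Open Scope classical_set_scope.
Local Open Scope ring_scope.

(** * A pointwise form of Minkowski's inequality *)

(** Convexity of the power, applied to the mean of [u / a] and [v / b] with
    weights [a / (a + b)] and [b / (a + b)].  Equality holds at [u = a],
    [v = b]; hence integrals of [u `^ p] and [v `^ p] bounded by [a `^ p] and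
    [b `^ p] give one of [(u + v) `^ p] bounded by [(a + b) `^ p]. *)
Lemma powR_triangle (R : realType) (p a b : R) : 1 <= p -> 0 < a -> 0 < b ->
  exists c1 c2 : R, [/\ 0 <= c1, 0 <= c2,
    c1 * a `^ p + c2 * b `^ p = (a + b) `^ p &
    forall u v, 0 <= u -> 0 <= v ->
      (u + v) `^ p <= c1 * u `^ p + c2 * v `^ p].
Proof.
move=> p1 a0 b0; have ab0 : 0 < a + b by rewrite addr_gt0.
have p0 : 0 <= p by rewrite (le_trans _ p1).
have [ap bp] : 0 < a `^ p /\ 0 < b `^ p by rewrite !powR_gt0.
exists ((a + b) `^ p * (a / (a + b)) / a `^ p).
exists ((a + b) `^ p * (b / (a + b)) / b `^ p).
split.
- by rewrite !mulr_ge0 ?invr_ge0 ?powR_ge0// ltW.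
- by rewrite !mulr_ge0 ?invr_ge0 ?powR_ge0// ltW.
- rewrite !divfK ?gt_eqF// -mulrDr -mulrDl divff ?mulr1// gt_eqF//.
move=> u v u0 v0.
have t01 : 0 <= a / (a + b) <= 1.
  apply/andP; split; first by rewrite divr_ge0 ?ltW.
  by rewrite ler_pdivrMr// mul1r lerDl ltW.
have bE : b / (a + b) = 1 - a / (a + b).
  by rewrite -[X in X - _](@divff _ (a + b)) ?gt_eqF// -mulrBl addrAC subrr add0r.
have /andP[t0 t1] := t01.
have cvx : (a / (a + b) * (u / a) + b / (a + b) * (v / b)) `^ p <=
    a / (a + b) * (u / a) `^ p + b / (a + b) * (v / b) `^ p.
  have := convex_powR p1 (Itv01 t0 t1) (x := u / a) (y := v / b).
  rewrite !inE/= !in_itv/= !andbT bE !convRE; apply.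
    by rewrite divr_ge0// ltW.
  by rewrite divr_ge0// ltW.
have uvE : u + v = (a + b) * (a / (a + b) * (u / a) + b / (a + b) * (v / b)).
  by field; rewrite !gt_eqF.
rewrite {1}uvE powRM ?(ltW ab0)//; last first.
  by rewrite addr_ge0// !mulr_ge0// ?invr_ge0// ltW.
apply: (le_trans (ler_wpM2l (powR_ge0 _ _) cvx)).
have powRdiv x y : 0 <= x -> 0 < y -> (x / y) `^ p = x `^ p / y `^ p.
  move=> x0 y0; rewrite powRM ?invr_ge0 ?(ltW y0)//; congr (_ * _).
  by rewrite -[in LHS]powR_inv1 ?(ltW y0)// -powRrM mulN1r powRN.
rewrite !powRdiv//.
by rewrite le_eqVlt; apply/orP; left; apply/eqP; ring.
Qed.

(** * Image measures, densities and averages *)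

Section probability_of_measure.
Context d (T : measurableType d) (R : realType).
Local Open Scope ereal_scope.

Lemma ex_probability (m : {measure set T -> \bar R}) : m setT = 1 ->
  exists P : probability T R, P = m :> (set T -> \bar R).
Proof.
move=> m1; exists (mnormalize m (\d_point : probability T R)).
apply/funext => A; rewrite /= /mnormalize m1 onee_eq0/=.
by rewrite invr1 mule1.
Qed.

End probability_of_measure.

Section image_measure.
Context d1 d2 (T1 : measurableType d1) (T2 : measurableType d2) (R : realType).
Variables (f : T1 -> T2) (mf : measurable_fun setT f).
Local Open Scope ereal_scope.

(** The image measure with its measurability proof as a parameter, so that
    its measure structure can be inferred. *)
Definition mimage (m : set T1 -> \bar R) (_ : measurable_fun setT f) :
  set T2 -> \bar R := pushforward m f.

Section measure.
Variable m : {measure set T1 -> \bar R}.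

Let pushm : {measure set T2 -> \bar R} :=
  measure_function_pushforward__canonical__measure_function_Measure m mf.

Let mimage0 : mimage m mf set0 = 0. Proof. exact: (measure0 pushm). Qed.

Let mimage_ge0 A : 0 <= mimage m mf A. Proof. exact: (measure_ge0 pushm). Qed.

Let mimage_sigma_additive : semi_sigma_additive (mimage m mf).
Proof. exact: (@measure_semi_sigma_additive _ _ _ pushm). Qed.

HB.instance Definition _ := isMeasure.Build _ _ _ (mimage m mf)
  mimage0 mimage_ge0 mimage_sigma_additive.

Lemma ge0_integral_mimage (h : T2 -> \bar R) : measurable_fun setT h ->
  (forall y, 0 <= h y) -> \int[mimage m mf]_y h y = \int[m]_x h (f x).
Proof. by move=> mh h0; rewrite ge0_integral_pushforward. Qed.

End measure.

Section probability.
Variable P : probability T1 R.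

Let mimageT : mimage P mf setT = 1.
Proof. by rewrite /mimage /pushforward preimage_setT probability_setT. Qed.

HB.instance Definition _ :=
  Measure_isProbability.Build _ _ _ (mimage P mf) mimageT.

End probability.

End image_measure.

Lemma measurable_propset d (T : measurableType d) (P : Prop) :
  measurable [set _ : T | P].
Proof.
have [HP|nP] := pselect P.
  by rewrite (_ : mkset _ = setT)//; apply/seteqP; split.
by rewrite (_ : mkset _ = set0)//; apply/seteqP; split.
Qed.

Section density.
Context d (T : measurableType d) (R : realType).
Variables (P : probability T R) (g : T -> \bar R).
Hypotheses (mg : measurable_fun setT g) (g0 : forall x, (0 <= g x)%E).
Local Open Scope ereal_scope.

Definition mdensity (_ : measurable_fun setT g) (_ : forall x, 0 <= g x) :
  set T -> \bar R := fun A => \int[P]_(x in A) g x.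

Local Notation nu := (mdensity mg g0).

Let nu0 : nu set0 = 0. Proof. exact: integral_set0. Qed.

Let nu_ge0 A : 0 <= nu A. Proof. by apply: integral_ge0 => x _; exact: g0. Qed.

Let nu_sigma_additive : semi_sigma_additive nu.
Proof. exact: semi_sigma_additive_nng_induced. Qed.

HB.instance Definition _ := isMeasure.Build _ _ _ nu nu0 nu_ge0
  nu_sigma_additive.

(** The density [g] is identified with the Radon-Nikodym derivative, for which
    the change of variables is known. *)
Lemma ex_density_probability : \int[P]_x g x = 1 ->
  exists Q : probability T R, forall f : T -> \bar R,
    measurable_fun setT f -> (forall x, 0 <= f x) ->
    \int[Q]_x f x = \int[P]_x (f x * g x).
Proof.
move=> g1; have [//|Q QE] := @ex_probability _ T R nu.
have QP : Q `<< P.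
  apply/null_content_dominatesP => A mA PA0; rewrite QE /mdensity.
  by apply: null_set_integral => //; exact: measurable_funTS.
have mf := measurable_int _ (Radon_Nikodym_SigmaFinite.f_integrable QP).
exists Q => f mf' f0; rewrite -(Radon_Nikodym_SigmaFinite.change_of_variables QP)//.
apply: ge0_ae_eq_integral => //.
- exact: emeasurable_funM.
- exact: emeasurable_funM.
- by move=> x _; rewrite mule_ge0// Radon_Nikodym_SigmaFinite.f_ge0.
- by move=> x _; rewrite mule_ge0.
- have : ae_eq P setT (Radon_Nikodym_SigmaFinite.f Q P) g.
    apply: integral_ae_eq => //.
    + exact: Radon_Nikodym_SigmaFinite.f_integrable.
    + move=> A AT mA; rewrite -Radon_Nikodym_SigmaFinite.f_integral//.
      by rewrite [LHS](congr1 (@^~ A) QE).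
  by apply: filterS => x /= + xT => ->.
Qed.

End density.

Section average.
Context d (T : measurableType d) (R : realType).
Variables (N : nat) (nu : nat -> probability T R).
Local Open Scope ereal_scope.

Definition average : set T -> \bar R :=
  mscale ((N.+1%:R)^-1)%:nng%R (msum nu N.+1).

HB.instance Definition _ := Measure.on average.

Lemma averageE A :
  average A = ((N.+1%:R)^-1)%R%:E * \sum_(j < N.+1) nu j A.
Proof. by []. Qed.

Lemma mean_const (r : R) :
  ((N.+1%:R)^-1)%R%:E * \sum_(j < N.+1) r%:E = r%:E.
Proof.
rewrite sumEFin -EFinM big_const_ord iter_addr_0 -[X in (_ * X)%R]mulr_natl.
by rewrite mulrA mulVf ?mul1r// pnatr_eq0.
Qed.

Lemma average_setT : average setT = 1.
Proof.
rewrite averageE (eq_bigr (fun=> 1%:E)) ?mean_const// => j _.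
exact: probability_setT.
Qed.

HB.instance Definition _ :=
  Measure_isProbability.Build _ _ _ average average_setT.

Lemma ge0_integral_average (f : T -> \bar R) : measurable_fun setT f ->
  (forall y, 0 <= f y) -> \int[average]_y f y =
  ((N.+1%:R)^-1)%R%:E * \sum_(j < N.+1) \int[nu j]_y f y.
Proof.
by move=> mf f0; rewrite ge0_integral_mscale// ge0_integral_measure_sum.
Qed.

Lemma mean_weighted_integral (m : {measure set T -> \bar R})
    (g : nat -> T -> \bar R) (f : T -> \bar R) :
  (forall j, measurable_fun setT (g j)) -> (forall j x, 0 <= g j x) ->
  {ae m, forall x, ((N.+1%:R)^-1)%R%:E * \sum_(j < N.+1) g j x = 1} ->
  measurable_fun setT f -> (forall x, 0 <= f x) ->
  ((N.+1%:R)^-1)%R%:E * \sum_(j < N.+1) \int[m]_x (f x * g j x) =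
  \int[m]_x f x.
Proof.
move=> mg g0 mean_g mf f0.
have mfg j : measurable_fun setT (fun x => f x * g j x).
  exact: emeasurable_funM.
have fg0 j x : 0 <= f x * g j x by exact: mule_ge0.
rewrite -ge0_integral_sum// -ge0_integralZl//; last 2 first.
- exact: emeasurable_sum.
- by move=> x _; exact: sume_ge0.
apply: ge0_ae_eq_integral => //.
- by apply: measurable_funeM; exact: emeasurable_sum.
- by move=> x _; rewrite mule_ge0// ?lee_fin//; exact: sume_ge0.
- have [A [mA A0 sub]] := mean_g; exists A; split => //.
  apply: subset_trans sub => x /=; apply: contra_not => gx _.
  by rewrite -ge0_sume_distrr// muleCA gx mule1.
Qed.

End average.

(** * Distances and couplings on Borel sets *)

Lemma measurable_of_generators (S T : pointedType) (GS : set (set S))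
    (GT : set (set T)) (f : g_sigma_algebraType GS -> g_sigma_algebraType GT) :
  (forall U, GT U -> GS (f @^-1` U)) -> measurable_fun setT f.
Proof.
move=> Gf; apply: (@measurability _ _ _ _ setT f GT) => //.
by move=> _ [U oU <-]; rewrite setTI; apply: sub_sigma_algebra; exact: Gf.
Qed.

Section borel_pairs.
Variables (R : realType) (Y : pmetricType R).

Lemma measurable_borel_swap : measurable_fun setT
  (fun z : borel (Y * Y)%type => (z.2, z.1) : borel (Y * Y)%type).
Proof.
apply: measurable_of_generators => U oU.
apply: (open_comp (f := fun z : Y * Y => (z.2, z.1))) => // z _.
by apply: cvg_pair; [exact: cvg_snd|exact: cvg_fst].
Qed.

Lemma measurable_borel_diag : measurable_fun setT
  (fun y : borel Y => (y, y) : borel (Y * Y)%type).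
Proof.
apply: measurable_of_generators => U oU.
apply: (open_comp (f := fun y : Y => (y, y))) => // y _.
by apply: cvg_pair; exact: cvg_id.
Qed.

Lemma measurable_borel_fst : measurable_fun setT
  (fun z : borel (Y * Y)%type => z.1 : borel Y).
Proof.
apply: measurable_of_generators => U oU.
by apply: (open_comp (f := fun z : Y * Y => z.1)) => // z _; exact: cvg_fst.
Qed.

Lemma measurable_borel_snd : measurable_fun setT
  (fun z : borel (Y * Y)%type => z.2 : borel Y).
Proof.
apply: measurable_of_generators => U oU.
by apply: (open_comp (f := fun z : Y * Y => z.2)) => // z _; exact: cvg_snd.
Qed.

Lemma measurable_borel_pairl (x : Y) : measurable_fun setT
  (fun y : borel Y => (x, y) : borel (Y * Y)%type).
Proof.
apply: measurable_of_generators => U oU.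
apply: (open_comp (f := fun y : Y => (x, y))) => // y _.
by apply: cvg_pair; [exact: cvg_cst|exact: cvg_id].
Qed.

End borel_pairs.

Section distance_power.
Variables (R : realType) (p : R) (Y : pmetricType R).

Definition dpow (x y : Y) : \bar R := ((mdist x y) `^ p)%:E.

Lemma dpow_ge0 x y : (0 <= dpow x y)%E.
Proof. by rewrite lee_fin powR_ge0. Qed.

Lemma dpow_sym x y : dpow x y = dpow y x.
Proof. by rewrite /dpow metric_sym. Qed.

Lemma measurable_dpow1 x : measurable_fun setT (dpow x : borel Y -> \bar R).
Proof. by apply: measurable_powEFin; exact: measurable_mdist1. Qed.

Lemma measurable_dpow2 :
  measurable_fun setT (fun z : borel (Y * Y)%type => dpow z.1 z.2).
Proof. by apply: measurable_powEFin; exact: measurable_mdist2. Qed.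

Lemma dpow_triangle (a b : R) : 1 <= p -> 0 < a -> 0 < b ->
  exists c1 c2 : R, [/\ 0 <= c1, 0 <= c2,
    c1 * a `^ p + c2 * b `^ p = (a + b) `^ p &
    forall x y z, (dpow x z <= c1%:E * dpow x y + c2%:E * dpow y z)%E].
Proof.
move=> p1 a0 b0; have [c1 [c2 [c10 c20 cE cT]]] := powR_triangle p1 a0 b0.
exists c1, c2; split => // x y z; rewrite lee_fin.
apply: (le_trans _ (cT _ _ (mdist_ge0 x y) (mdist_ge0 y z))).
apply: ge0_ler_powR; rewrite ?nnegrE ?addr_ge0 ?mdist_ge0//.
- by rewrite (le_trans _ p1).
- exact: metric_triangle.
Qed.

End distance_power.

Section wasserstein_bounds.
Variables (R : realType) (p : R) (Y : pmetricType R).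
Hypothesis p1 : 1 <= p.
Local Open Scope ereal_scope.

Let p0 : (0 < p)%R. Proof. by rewrite (lt_le_trans _ p1). Qed.

Lemma cost_ge0 (gamma : probability (borel (Y * Y)%type) R) : 0 <= cost p gamma.
Proof. by apply: integral_ge0 => z _; exact: dpow_ge0. Qed.

Lemma Wp_le_of_cost (mu nu : Pp p Y) gamma (a : R) : (0 <= a)%R ->
  coupling (sval mu) (sval nu) gamma -> cost p gamma <= (a `^ p)%:E ->
  (Wp mu nu <= a)%R.
Proof.
move=> a0 gP; case: (cost p gamma) (cost_ge0 gamma) (@Wp_le _ _ _ mu nu gamma) => //.
move=> c c0 /(_ _ gP erefl) Wc; rewrite lee_fin => ca.
apply: (le_trans Wc); rewrite -[leRHS](@powRr1 _ a)//.
rewrite -(@mulfV _ p) ?gt_eqF// powRrM.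
by apply: ge0_ler_powR; rewrite ?nnegrE ?invr_ge0 ?powR_ge0// ltW.
Qed.

(** The finiteness hypothesis rules out the case where the infimum defining
    [Wp] is infinite, in which its real part [fine] would be zero. *)
Lemma coupling_of_Wp_lt (mu nu : Pp p Y) (a : R) :
  (exists2 gamma, coupling (sval mu) (sval nu) gamma & cost p gamma < +oo) ->
  (Wp mu nu < a)%R ->
  exists2 gamma, coupling (sval mu) (sval nu) gamma & cost p gamma < (a `^ p)%:E.
Proof.
move=> [g0 g0P g0c] Wa.
have a0 : (0 < a)%R by rewrite (le_lt_trans _ Wa)// Wp_ge0.
have : ereal_inf [set cost p gamma `^ p^-1 |
    gamma in coupling (sval mu) (sval nu)] < a%:E.
  rewrite -lte_fin in Wa; apply: le_lt_trans Wa; rewrite /Wp fineK//.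
  rewrite ge0_fin_numE; last first.
    by apply: le_ereal_inf_tmp => _ [g _ <-]; exact: poweR_ge0.
  apply: (@le_lt_trans _ _ (cost p g0 `^ p^-1)).
    by apply: ereal_inf_lbound; exists g0.
  exact: poweR_lty.
move=> /ereal_inf_lt[_ [g gP <-] ga]; exists g => //.
have : cost p g < +oo.
  by apply: (@lty_poweRy _ _ p^-1); rewrite ?invr_eq0 ?gt_eqF// (lt_trans ga) ?ltry.
move: ga (cost_ge0 g); case: (cost p g) => // c; rewrite poweR_EFin !lte_fin lee_fin.
move=> ca c0 _; rewrite -[ltLHS](@powRr1 _ c)// -(@mulVf _ p) ?gt_eqF// powRrM.
by apply: gt0_ltr_powR; rewrite ?nnegrE ?powR_ge0// ltW.
Qed.

Lemma coupling_sym (mu nu : probability (borel Y) R) gamma :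
  coupling mu nu gamma ->
  exists2 gamma', coupling nu mu gamma' & cost p gamma' = cost p gamma.
Proof.
move=> gP.
exists (mimage gamma (@measurable_borel_swap R Y)).
  by move=> B mB; split; [exact: (gP _ mB).2|exact: (gP _ mB).1].
rewrite /cost ge0_integral_mimage//=.
- by apply: eq_integral => z _ /=; rewrite metric_sym.
- exact: measurable_dpow2.
- by move=> z; exact: dpow_ge0.
Qed.

Lemma Wp_sym (mu nu : Pp p Y) : Wp mu nu = Wp nu mu.
Proof.
rewrite /Wp; congr fine; apply/eqP; rewrite eq_le; apply/andP; split;
  apply: le_ereal_inf => _ [g gP <-];
  by have [g' g'P <-] := coupling_sym gP; exists g'.
Qed.

Lemma Wp_refl (mu : Pp p Y) : Wp mu mu = 0%R.
Proof.
apply/eqP; rewrite eq_le Wp_ge0 andbT.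
apply: (@Wp_le_of_cost _ _ (mimage (sval mu) (@measurable_borel_diag R Y))) => //.
rewrite /cost ge0_integral_mimage//=.
- rewrite integral0_eq ?lee_fin ?powR_ge0// => y _ /=.
  by rewrite mdistxx powR0// gt_eqF.
- exact: measurable_dpow2.
- by move=> z; exact: dpow_ge0.
Qed.

End wasserstein_bounds.

(** * Splitting a measure over the points of an empirical measure *)

Section splitting.
Variables (R : realType) (Y : pmetricType R).
Local Open Scope ereal_scope.

(** A coupling of the empirical measure on [x 0, ..., x N] with [mu] amounts to
    such an average: [nu j] is the part of [mu] transported to [x j], and
    [splitcost] is the cost of the coupling. *)
Definition splits N (nu : nat -> probability (borel Y) R)
    (mu : probability (borel Y) R) : Prop :=
  forall B : set (borel Y), measurable B -> mu B = average N nu B.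

Definition splitcost (p : R) N (x : nat -> Y)
    (nu : nat -> probability (borel Y) R) : \bar R :=
  ((N.+1%:R)^-1)%R%:E * \sum_(j < N.+1) \int[nu j]_y dpow p (x j) y.

Lemma splits_ge0_integral N nu mu (f : borel Y -> \bar R) :
  splits N nu mu -> measurable_fun setT f -> (forall y, 0 <= f y) ->
  \int[mu]_y f y = ((N.+1%:R)^-1)%R%:E * \sum_(j < N.+1) \int[nu j]_y f y.
Proof.
move=> numu mf f0; rewrite -ge0_integral_average//.
by apply: eq_measure_integral => A mA _; exact: numu.
Qed.

Lemma split_null N eta mu (A : set (borel Y)) j : splits N eta mu ->
  (j < N.+1)%N -> measurable A -> mu A = 0 -> eta j A = 0.
Proof.
move=> etaP jN mA; rewrite etaP// averageE => /eqP.
rewrite mule_eq0 eqe invr_eq0 pnatr_eq0/= => /eqP s0.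
apply/eqP; rewrite eq_le measure_ge0 andbT.
by rewrite -s0 (bigD1 (Ordinal jN))//= leeDl// sume_ge0.
Qed.

Section coupled.
Variables (mu nu : probability (borel Y) R).
Variables (gamma : probability (borel (Y * Y)%type) R).
Hypothesis gP : coupling mu nu gamma.

Lemma coupling_integral_fst (f : borel Y -> \bar R) :
  measurable_fun setT f -> (forall y, 0 <= f y) ->
  \int[gamma]_z f z.1 = \int[mu]_y f y.
Proof.
move=> mf f0.
rewrite -(ge0_integral_mimage (@measurable_borel_fst R Y) gamma mf f0).
by apply: eq_measure_integral => A mA _; exact: (gP mA).1.
Qed.

Lemma coupling_integral_snd (f : borel Y -> \bar R) :
  measurable_fun setT f -> (forall y, 0 <= f y) ->
  \int[gamma]_z f z.2 = \int[nu]_y f y.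
Proof.
move=> mf f0.
rewrite -(ge0_integral_mimage (@measurable_borel_snd R Y) gamma mf f0).
by apply: eq_measure_integral => A mA _; exact: (gP mA).2.
Qed.

Lemma coupling_ae_fst (P : Y -> Prop) :
  {ae mu, forall y, P y} -> {ae gamma, forall z, P z.1}.
Proof.
move=> [A [mA A0 PA]]; exists (fst @^-1` A); split.
- rewrite -[X in measurable X]setTI; exact: (@measurable_borel_fst R Y).
- by rewrite -A0; exact: (gP mA).1.
- by move=> z /= nP; apply: PA.
Qed.

Variables (N : nat) (g : nat -> borel Y -> \bar R).
Hypotheses (mg : forall j, measurable_fun setT (g j))
           (g0 : forall j y, 0 <= g j y)
           (g1 : forall j, (j < N.+1)%N -> \int[mu]_y g j y = 1)
           (mean_g : {ae mu, forall y,
              ((N.+1%:R)^-1)%R%:E * \sum_(j < N.+1) g j y = 1}).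

Let mg1 j : measurable_fun setT (fun z : borel (Y * Y)%type => g j z.1).
Proof. exact: (measurableT_comp (mg j) (@measurable_borel_fst R Y)). Qed.

Lemma mean_weighted_coupling (h : borel (Y * Y)%type -> \bar R) :
  measurable_fun setT h -> (forall z, 0 <= h z) ->
  ((N.+1%:R)^-1)%R%:E * \sum_(j < N.+1) \int[gamma]_z (h z * g j z.1) =
  \int[gamma]_z h z.
Proof.
move=> mh h0.
apply: (@mean_weighted_integral _ _ R N gamma (fun j z => g j z.1) h) => //.
exact: coupling_ae_fst mean_g.
Qed.

(** Reweighting a coupling by densities on its first coordinate and projecting
    to the second one distributes [nu] among the [N.+1] indices. *)
Lemma split_of_densities : exists eta : nat -> probability (borel Y) R,
  splits N eta nu /\ forall j (f : borel Y -> \bar R), (j < N.+1)%N ->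
    measurable_fun setT f -> (forall y, 0 <= f y) ->
    \int[eta j]_y f y = \int[gamma]_z (f z.2 * g j z.1).
Proof.
have exQ j : exists Q : probability (borel (Y * Y)%type) R, (j < N.+1)%N ->
    forall f, measurable_fun setT f -> (forall z, 0 <= f z) ->
    \int[Q]_z f z = \int[gamma]_z (f z * g j z.1).
  have [jN|_] := boolP (j < N.+1)%N; last by exists gamma.
  have [||Q QE] := @ex_density_probability _ _ R gamma _ (mg1 j).
  - by move=> z; exact: g0.
  - by rewrite (coupling_integral_fst (mg j))// g1.
  - by exists Q => _ f mf f0; exact: QE.
have [Q QE] := choice exQ.
exists (fun j => mimage (Q j) (@measurable_borel_snd R Y)).
have eta_int j f : (j < N.+1)%N -> measurable_fun setT f ->
    (forall y, 0 <= f y) ->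
    \int[mimage (Q j) (@measurable_borel_snd R Y)]_y f y =
    \int[gamma]_z (f z.2 * g j z.1).
  move=> jN mf f0; rewrite ge0_integral_mimage// QE//.
  exact: (measurableT_comp mf (@measurable_borel_snd R Y)).
split; last exact: eta_int.
move=> B mB; rewrite averageE.
have mI : measurable_fun setT (fun y : borel Y => (\1_B y)%:E : \bar R).
  exact/measurable_EFinP.
have I0 y : 0 <= (\1_B y)%:E :> \bar R by rewrite lee_fin.
transitivity (\int[nu]_y (\1_B y)%:E); first by rewrite integral_indic// setIT.
rewrite -(coupling_integral_snd mI I0).
rewrite -mean_weighted_coupling//; last first.
  exact: (measurableT_comp mI (@measurable_borel_snd R Y)).
congr (_ * _); apply: eq_bigr => j _.
by rewrite -(eta_int j (fun y => (\1_B y)%:E))// integral_indic// setIT.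
Qed.

End coupled.
End splitting.

Section empirical_couplings.
Variables (R : realType) (Y : pmetricType R).
Local Open Scope ereal_scope.

(** The piece [m k] is transported as a whole to the point [z k]. *)
Lemma coupling_of_pieces p M (m : nat -> {measure set (borel Y) -> \bar R})
    (z : nat -> Y) (mu nu : probability (borel Y) R) :
  (forall B : set (borel Y), measurable B ->
     mu B = \sum_(k < M) m k setT * \d_(z k : borel Y) B) ->
  (forall B : set (borel Y), measurable B -> nu B = \sum_(k < M) m k B) ->
  exists2 gamma, coupling mu nu gamma &
    cost p gamma = \sum_(k < M) \int[m k]_y dpow p (z k) y.
Proof.
move=> muE nuE.
pose im k : {measure set (borel (Y * Y)%type) -> \bar R} :=
  mimage (m k) (@measurable_borel_pairl R Y (z k)).
have [|gamma gE] := @ex_probability _ _ R (msum im M).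
  rewrite -(probability_setT nu) nuE//.
exists gamma.
  move=> B mB; rewrite gE muE// nuE//; split; last by [].
  apply: eq_bigr => k _; rewrite /im /= /mimage /pushforward diracE.
  have [zB|zB] := boolP (z k \in B).
    rewrite mule1; congr (m k _); apply/seteqP; split => // y _ /=.
    exact: set_mem.
  rewrite mule0 -(measure0 (m k)); congr (m k _).
  by apply/seteqP; split => // y /= /mem_set; rewrite (negPf zB).
rewrite /cost gE ge0_integral_measure_sum//.
- apply: eq_bigr => k _; rewrite ge0_integral_mimage//.
  + exact: measurable_dpow2.
  + by move=> y; exact: dpow_ge0.
- by move=> x _; exact: dpow_ge0.
- exact: measurable_dpow2.
Qed.

Lemma coupling_of_split p N (x : nat -> Y) eta (nu : probability (borel Y) R) :
  splits N eta nu ->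
  exists2 gamma, coupling (empirical R N (x : nat -> borel Y)) nu gamma &
    cost p gamma = splitcost p N x eta.
Proof.
move=> etanu.
have [||gamma gP gc] := @coupling_of_pieces p N.+1
  (fun k => mscale ((N.+1%:R)^-1)%:nng%R (eta k)) x
  (empirical R N (x : nat -> borel Y)) nu.
- move=> B mB /=; rewrite empiricalE ge0_sume_distrr//.
  apply: eq_bigr => k _; rewrite /= /mscale; congr (_ * _).
  by rewrite [X in _ * X](@probability_setT _ _ _ (eta k)) mule1.
- by move=> B mB; rewrite etanu// averageE ge0_sume_distrr.
exists gamma => //; rewrite gc /splitcost ge0_sume_distrr; last first.
  by move=> k _; apply: integral_ge0 => y _; exact: dpow_ge0.
apply: eq_bigr => k _; rewrite ge0_integral_mscale//.
- exact: measurable_dpow1.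
- by move=> y _; exact: dpow_ge0.
Qed.

(** An atom of mass [w] that is listed several times is shared evenly between
    its indices: the density of each of them is [w^-1] on the atom. *)
Lemma atom_densities N (x : nat -> Y) : exists g : nat -> borel Y -> \bar R,
  [/\ forall j, measurable_fun setT (g j), forall j y, 0 <= g j y,
      forall j, (j < N.+1)%N ->
        \int[empirical R N (x : nat -> borel Y)]_y g j y = 1,
      {ae empirical R N (x : nat -> borel Y), forall y,
        ((N.+1%:R)^-1)%R%:E * \sum_(j < N.+1) g j y = 1} &
      forall j y, g j y = 0 \/ x j = y].
Proof.
pose w y : R := (N.+1%:R^-1 * \sum_(k < N.+1) (x k == y)%:R)%R.
have w_gt0 j : (j < N.+1)%N -> (0 < w (x j))%R.
  move=> jN; rewrite mulr_gt0// (bigD1 (Ordinal jN))//= eqxx.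
  by rewrite ltr_pwDl// sumr_ge0.
have mx j : measurable ([set x j] : set (borel Y)).
  exact: (compact_borel (@compact_set1 Y (x j))).
pose g j (y : borel Y) : \bar R := ((w (x j))^-1 * \1_[set x j] y)%:E.
have mg j : measurable_fun setT (g j).
  by apply/measurable_EFinP; apply: measurable_funM => //; exact: measurable_indic.
have w_ge0 y : (0 <= w y)%R by rewrite mulr_ge0// sumr_ge0.
have g0 j y : 0 <= g j y by rewrite lee_fin mulr_ge0// invr_ge0.
have indE j y : (\1_[set x j] y = (x j == y)%:R :> R)%R.
  rewrite indicE; have [<-|xy] := eqVneq (x j) y; first by rewrite mem_set.
  by rewrite memNset// => /= yx; rewrite yx eqxx in xy.
have g1 j : (j < N.+1)%N ->
    \int[empirical R N (x : nat -> borel Y)]_y g j y = 1.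
  move=> jN; rewrite integral_empirical// /g.
  rewrite (eq_bigr (fun k : 'I_N.+1 =>
    ((w (x j))^-1)%:E * (x k == x j)%:R%:E)); last first.
    by move=> k _; rewrite indE eq_sym EFinM.
  rewrite -ge0_sume_distrr; last by move=> k _; rewrite lee_fin.
  by rewrite sumEFin muleCA -!EFinM mulVf ?gt_eqF// w_gt0.
have gmean : {ae empirical R N (x : nat -> borel Y), forall y,
    ((N.+1%:R)^-1)%R%:E * \sum_(j < N.+1) g j y = 1}.
  have mF : measurable (x @` `I_N.+1 : set (borel Y)).
    apply: (@compact_borel _ Y); apply: finite_compact.
    exact/finite_image/finite_II.
  exists (~` (x @` `I_N.+1)); split; first exact: measurableC.
    rewrite /= empiricalE big1 ?mule0// => j _; rewrite diracE memNset//.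
    by apply; exists j => /=.
  move=> y /=; apply: contra_not => -[k kN <-].
  rewrite /g (eq_bigr (fun j : 'I_N.+1 =>
    ((w (x k))^-1)%:E * (x j == x k)%:R%:E)); last first.
    move=> j _; rewrite indE; have [->|_] := eqVneq (x j) (x k).
      by rewrite EFinM.
    by rewrite mulr0 mule0.
  rewrite -ge0_sume_distrr; last by move=> j _; rewrite lee_fin.
  by rewrite sumEFin muleCA -!EFinM mulVf ?gt_eqF// w_gt0.
exists g; split => // j y; rewrite /g indE.
by have [->|_] := eqVneq (x j) y; [right|left; rewrite mulr0].
Qed.

(** The converse of [coupling_of_split]: the pieces are the conditional measures
    given the first coordinate. *)
Lemma split_of_coupling p N (x : nat -> Y) (nu : probability (borel Y) R) gamma :
  coupling (empirical R N (x : nat -> borel Y)) nu gamma ->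
  exists2 eta, splits N eta nu & splitcost p N x eta = cost p gamma.
Proof.
move=> gP; have [g [mg g0 g1 gmean gx]] := atom_densities N x.
have [eta [etanu eta_int]] := split_of_densities gP mg g0 g1 gmean.
exists eta => //; rewrite /cost.
have md := @measurable_dpow2 R p Y.
rewrite -(mean_weighted_coupling gP mg g0 gmean md); last first.
  by move=> z; exact: dpow_ge0.
congr (_ * _); apply: eq_bigr => j _.
have -> : \int[eta j]_y dpow p (x j) y =
    \int[gamma]_z (dpow p (x j) z.2 * g j z.1).
  apply: (eta_int j (fun y => dpow p (x j) y)) => //.
  - exact: measurable_dpow1.
  - by move=> y; exact: dpow_ge0.
by apply: eq_integral => z _; have [->|->] := gx j z.1; rewrite ?mule0.
Qed.

(** Triangle inequality along [empirical x -> beta -> nu]: each piece of the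
    splitting of [beta] has a density, which carries it through the coupling. *)
Lemma split_trans p N (x : nat -> Y) (beta nu : probability (borel Y) R)
    eta gamma (a b : R) : (1 <= p)%R -> (0 < a)%R -> (0 < b)%R ->
  splits N eta beta -> splitcost p N x eta <= (a `^ p)%:E ->
  coupling beta nu gamma -> cost p gamma <= (b `^ p)%:E ->
  exists2 eta', splits N eta' nu & splitcost p N x eta' <= ((a + b) `^ p)%:E.
Proof.
move=> p1 a0 b0 etaP etac gP gc.
have dom j : (j < N.+1)%N -> eta j `<< beta.
  move=> jN; apply/null_content_dominatesP => A mA A0.
  exact: (split_null etaP jN mA A0).
(* The indices beyond [N] are unconstrained; their densities are set to 0. *)
pose g j : borel Y -> \bar R := if (j < N.+1)%N then
  Radon_Nikodym_SigmaFinite.f (eta j) beta else cst 0.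
have gE j : (j < N.+1)%N -> g j = Radon_Nikodym_SigmaFinite.f (eta j) beta.
  by rewrite /g => ->.
have mg j : measurable_fun setT (g j).
  rewrite /g; case: ifPn => // jN; apply: measurable_int.
  by apply: Radon_Nikodym_SigmaFinite.f_integrable; exact: dom.
have g0 j y : 0 <= g j y.
  rewrite /g; case: ifPn => // jN.
  by apply: Radon_Nikodym_SigmaFinite.f_ge0; exact: dom.
have g_int j (A : set (borel Y)) : (j < N.+1)%N -> measurable A ->
    \int[beta]_(y in A) g j y = eta j A.
  by move=> jN mA; rewrite gE// -Radon_Nikodym_SigmaFinite.f_integral//; exact: dom.
have g1 j : (j < N.+1)%N -> \int[beta]_y g j y = 1.
  by move=> jN; rewrite g_int// probability_setT.
have gmean : {ae beta, forall y,
    ((N.+1%:R)^-1)%R%:E * \sum_(j < N.+1) g j y = 1}.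
  have : ae_eq beta setT (cst 1)
      (fun y => ((N.+1%:R)^-1)%R%:E * \sum_(j < N.+1) g j y).
    apply: integral_ae_eq => //.
    - exact: finite_measure_integrable_cst.
    - by apply: measurable_funeM; exact: emeasurable_sum.
    - move=> A _ mA; rewrite integral_cst// mul1e.
      rewrite [LHS](etaP _ mA) averageE.
      rewrite ge0_integralZl//.
      + rewrite ge0_integral_sum//; last by move=> j; exact: measurable_funTS.
        by congr (_ * _); apply: eq_bigr => j _; rewrite g_int.
      + by apply: emeasurable_sum => j; exact: measurable_funTS.
      + by move=> y _; exact: sume_ge0.
  move=> [A [mA A0 sub]]; exists A; split => //.
  by apply: subset_trans sub => y /=; apply: contra_not => /(_ I) <-.
have [eta' [eta'nu eta'_int]] := split_of_densities gP mg g0 g1 gmean.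
exists eta' => //.
have [c1 [c2 [c10 c20 cE cT]]] := dpow_triangle Y p1 a0 b0.
have md1 j := @measurable_dpow1 R p Y (x j).
have md2 := @measurable_dpow2 R p Y.
have mg1 j : measurable_fun setT (fun z : borel (Y * Y)%type => g j z.1).
  exact: (measurableT_comp (mg j) (@measurable_borel_fst R Y)).
have md11 j : measurable_fun setT (fun z : borel (Y * Y)%type => dpow p (x j) z.1).
  exact: (measurableT_comp (md1 j) (@measurable_borel_fst R Y)).
have md12 j : measurable_fun setT (fun z : borel (Y * Y)%type => dpow p (x j) z.2).
  exact: (measurableT_comp (md1 j) (@measurable_borel_snd R Y)).
have d0 y z : 0 <= dpow p y z :> \bar R by exact: dpow_ge0.
apply: (@le_trans _ _ (c1%:E * splitcost p N x eta + c2%:E * cost p gamma)).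
  have -> : cost p gamma = (N.+1%:R^-1)%:E *
      \sum_(j < N.+1) \int[gamma]_z (dpow p z.1 z.2 * g j z.1).
    by rewrite (mean_weighted_coupling gP mg g0 gmean md2).
  rewrite /splitcost !(muleCA _ (N.+1%:R^-1)%:E) -ge0_muleDr; last 2 first.
  - by rewrite mule_ge0// sume_ge0// => j _; exact: integral_ge0.
  - rewrite mule_ge0// sume_ge0// => j _; apply: integral_ge0 => z _.
    exact: mule_ge0.
  apply: lee_pmul => //.
    by apply: sume_ge0 => j _; exact: integral_ge0.
  rewrite ge0_sume_distrr; last by move=> j _; exact: integral_ge0.
  rewrite ge0_sume_distrr; last first.
    by move=> j _; apply: integral_ge0 => z _; exact: mule_ge0.
  rewrite -big_split/=; apply: lee_sum => j _.
  have -> : \int[eta' j]_y dpow p (x j) y =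
      \int[gamma]_z (dpow p (x j) z.2 * g j z.1).
    exact: (eta'_int j (fun y => dpow p (x j) y)).
  have -> : \int[eta j]_y dpow p (x j) y =
      \int[gamma]_z (dpow p (x j) z.1 * g j z.1).
    rewrite (coupling_integral_fst gP (f := fun y => dpow p (x j) y * g j y)).
    - rewrite gE// Radon_Nikodym_SigmaFinite.change_of_variables//.
      exact: dom.
    - exact: emeasurable_funM.
    - by move=> y; exact: mule_ge0.
  rewrite -!ge0_integralZl//; last 4 first.
  - exact: emeasurable_funM.
  - by move=> z _; exact: mule_ge0.
  - exact: emeasurable_funM.
  - by move=> z _; exact: mule_ge0.
  rewrite -ge0_integralD//; last 4 first.
  - by move=> z _; rewrite mule_ge0// mule_ge0.
  - by apply: measurable_funeM; exact: emeasurable_funM.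
  - by move=> z _; rewrite mule_ge0// mule_ge0.
  - by apply: measurable_funeM; exact: emeasurable_funM.
  apply: ge0_le_integral => //.
  - by move=> z _; exact: mule_ge0.
  - exact: emeasurable_funM.
  - by apply: emeasurable_funD; apply: measurable_funeM; exact: emeasurable_funM.
  - move=> z _; rewrite !muleA -ge0_muleDl ?mule_ge0//.
    by apply: lee_pmul.
rewrite -cE EFinD !EFinM; apply: leeD; exact: lee_wpmul2l.
Qed.

End empirical_couplings.

(** * Product couplings of Radon measures *)

Section separable_support.
Variables (R : realType) (Y : pmetricType R).

Lemma open_mdist_ball (x : Y) (e : R) : open (ball x e).
Proof.
rewrite openE => y; rewrite ballEmdist /= => xy; apply/nbhs_ballP.
exists (e - mdist x y); first by rewrite /= subr_gt0.
move=> z; rewrite !ballEmdist /= => yz.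
by have := metric_triangle x y z; lra.
Qed.

Lemma compact_net (K : set Y) (e : R) : compact K -> 0 < e ->
  exists s : seq Y, forall y, K y -> exists2 x, x \in s & mdist x y < e.
Proof.
move=> cK e0; have := cK; rewrite compact_cover => /(_ Y setT (fun x => ball x e)).
case=> [x _||D _ KD].
- exact: open_mdist_ball.
- by move=> y Ky; exists y => //; exact: ballxx.
- exists (finmap.enum_fset D) => y /KD[x /= xD]; rewrite ballEmdist => xy.
  by exists x.
Qed.

Definition countable_net (K : set Y) (q : nat * nat * nat -> Y) : Prop :=
  forall y (n : nat), K y -> exists i, mdist (q i) y < n.+1%:R^-1.

(** A Radon probability measure is carried by a countable union of compact
    sets, hence by a separable set. *)
Lemma radon_separable_support (mu : probability (borel Y) R) : radon mu ->
  exists (K : set (borel Y)) q, [/\ measurable K, mu K = 1%E & countable_net K q].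
Proof.
move=> rmu.
have cpt (n : nat) : exists K : set Y, compact K /\ ((1 - n.+1%:R^-1)%:E < mu K)%E.
  have : ((1 - n.+1%:R^-1)%:E < mu setT)%E.
    by rewrite probability_setT lte_fin ltrBlDr ltrDl invr_gt0.
  rewrite (rmu _ measurableT) => /ereal_sup_gt[_ [K [cK _] <-] ?].
  by exists K.
have [K /all_and2[cK muK]] := choice cpt.
have net nm : exists s : seq Y, forall y, K nm.1 y ->
    exists2 x, x \in s & mdist x y < nm.2.+1%:R^-1.
  by apply: compact_net => //; rewrite invr_gt0.
have [s sP] := choice net.
have mK n : measurable (K n : set (borel Y)) by exact: compact_borel.
have mUK : measurable (\bigcup_n K n : set (borel Y)) by exact: bigcupT_measurable.
exists (\bigcup_n K n), (fun i => nth point (s i.1) i.2); split=> //.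
  apply/eqP; rewrite eq_le probability_le1//=.
  apply/lee_addgt0Pr => e e0.
  have [n /= ne] := @ltr_add_invr R 0 e e0; rewrite add0r in ne.
  rewrite -leeBlDr//; apply: (@le_trans _ _ (mu (K n))).
    apply/ltW/(le_lt_trans _ (muK n)); rewrite -EFinB lee_fin lerD2l lerN2.
    exact: ltW.
  by apply: le_measure; rewrite ?inE//; exact: bigcup_sup.
move=> y m [n _ Kny]; have [x xs xy] := sP (n, m) y Kny.
by exists (n, m, index x (s (n, m))); rewrite /= nth_index.
Qed.

Variables (K1 K2 : set (borel Y)) (q1 q2 : nat * nat * nat -> Y).
Hypotheses (mK1 : measurable K1) (mK2 : measurable K2).
Hypotheses (K1q : countable_net K1 q1) (K2q : countable_net K2 q2).

Let K := K1 `*` K2 : set (borel Y * borel Y).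

Let mK : measurable K. Proof. exact: measurableX. Qed.

(** The product of two Borel sigma-algebras may miss open sets of the product
    space.  Within a separable rectangle it does not: an open set is there a
    countable union of rectangles of balls. *)
Lemma measurable_open_rectangle (C : set (Y * Y)) : open C ->
  measurable (C `&` K : set (borel Y * borel Y)).
Proof.
move=> oC.
pose rect (i : nat * nat * nat * (nat * nat * nat) * nat) : set (Y * Y) :=
  ball (q1 i.1.1) i.2.+1%:R^-1 `*` ball (q2 i.1.2) i.2.+1%:R^-1.
have mball (x : Y) (e : R) : measurable (ball x e : set (borel Y)).
  by apply: sub_sigma_algebra; exact: open_mdist_ball.
have -> : C `&` K = (\bigcup_(i in [set i | rect i `<=` C]) rect i) `&` K.
  apply/seteqP; split=> -[u v] [Cuv [/= K1u K2v]]; last first.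
    by split => //; case: Cuv => i /= iC /iC.
  split=> //.
  have : nbhs (u, v) C by exact: open_nbhs_nbhs.
  move=> [[U V] /= [/nbhs_ballP[e1 /= e10 uU] /nbhs_ballP[e2 /= e20 vV]] UVC].
  have e0 : 0 < Num.min e1 e2 / 2 by rewrite divr_gt0// lt_min e10.
  have [n /=] := ltr_add_invr e0; rewrite add0r => ne.
  have [i1 qu] := K1q n K1u; have [i2 qv] := K2q n K2v.
  exists (i1, i2, n); last by split; rewrite /= ballEmdist.
  have step x y z : mdist x y < n.+1%:R^-1 :> R -> ball x n.+1%:R^-1 z ->
      mdist (y : Y) z < Num.min e1 e2.
    rewrite ballEmdist /= => xy xz.
    have := metric_triangle y x z; rewrite (metric_sym y x).
    move: ne xy xz; move: (Num.min e1 e2) (n.+1%:R^-1) => e i ne xy xz.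
    by lra.
  move=> [u' v'] [/= /(step _ _ _ qu) uu' /(step _ _ _ qv) vv'].
  move: uu' vv'; rewrite !lt_min => /andP[uu' _] /andP[_ vv'].
  by apply: UVC; split => /=; [apply: uU|apply: vV]; rewrite ballEmdist.
apply: measurableI => //; rewrite bigcup_mkcond.
apply: countable_bigcupT_measurable => // i.
by case: ifP => // _; apply: measurableX; exact: mball.
Qed.

(** The identity on [K], made measurable from the product sigma-algebra to the
    Borel sets of the product space.  The value off [K] lies on the diagonal, so
    that no distance bound has to exclude the complement of [K]. *)
Definition retract (x : Y) (z : borel Y * borel Y) : borel (Y * Y)%type :=
  if z \in K then (z.1, z.2) else (x, x).

Lemma measurable_retract x : measurable_fun setT (retract x).
Proof.
apply: (@measurability _ _ _ _ setT (retract x) (@open (Y * Y)%type)) => //.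
move=> _ [C oC <-]; rewrite setTI.
have -> : retract x @^-1` C = (C `&` K) `|` ([set _ | C (x, x)] `&` ~` K).
  apply/seteqP; split=> -[u v]; rewrite /retract /=.
    have [uvK|uvK] := boolP ((u, v) \in K) => ?; [left|right]; split=> //.
      exact: set_mem.
    by move=> /mem_set; rewrite (negPf uvK).
  by case=> -[? uvK]; [rewrite mem_set|rewrite memNset].
apply: measurableU; first exact: measurable_open_rectangle.
apply: measurableI; last exact: measurableC.
exact: measurable_propset.
Qed.

End separable_support.

Section product_coupling.
Variables (R : realType) (Y : pmetricType R).
Local Open Scope ereal_scope.

Lemma probability_eq_on d (T : measurableType d) (P : probability T R)
    (S A B : set T) : measurable S -> P S = 1 -> measurable A -> measurable B ->
  A `&` S = B `&` S -> P A = P B.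
Proof.
move=> mS PS mA mB AB.
have PSC (C : set T) : measurable C -> P C = P (C `&` S).
  move=> mC; rewrite (measureDI P mC mS).
  rewrite [X in X + _](_ : _ = 0) ?add0e//.
  apply/eqP; rewrite eq_le measure_ge0 andbT.
  apply: (@le_trans _ _ (P (~` S))).
    apply: le_measure; rewrite ?inE; last by move=> t [].
      exact: measurableD.
    exact: measurableC.
  by rewrite probability_setC// PS subee.
by rewrite PSC// AB -PSC.
Qed.

Lemma split_full_measure N eta (mu : probability (borel Y) R) (K : set (borel Y)) :
  splits N eta mu -> measurable K -> mu K = 1 ->
  forall j, (j < N.+1)%N -> eta j K = 1.
Proof.
move=> etaP mK muK j jN.
have : mu (~` K) = 0 by rewrite probability_setC// muK subee.
move=> /(split_null etaP jN (measurableC mK)) e0.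
by have := probability_setC (eta j) (measurableC mK); rewrite setCK e0 sube0.
Qed.

(** Triangle inequality along [mu -> empirical x -> nu]: pieces sitting over
    the same atom are coupled independently. *)
Lemma coupling_of_splits p N (x : nat -> Y) (mu nu : probability (borel Y) R)
    eta theta (a b : R) : (1 <= p)%R -> (0 < a)%R -> (0 < b)%R ->
  radon mu -> radon nu ->
  splits N eta mu -> splitcost p N x eta <= (a `^ p)%:E ->
  splits N theta nu -> splitcost p N x theta <= (b `^ p)%:E ->
  exists2 gamma, coupling mu nu gamma & cost p gamma <= ((a + b) `^ p)%:E.
Proof.
move=> p1 a0 b0 /radon_separable_support[K1 [q1 [mK1 muK1 K1q]]].
move=> /radon_separable_support[K2 [q2 [mK2 nuK2 K2q]]] etaP etac thetaP thetac.
have mphi j := measurable_retract mK1 mK2 K1q K2q (x j).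
pose phi j := retract K1 K2 (x j).
pose pr j : probability (borel Y * borel Y)%type R := eta j \x theta j.
pose gamma := average N (fun j => mimage (pr j) (mphi j)).
have prX j A B : measurable A -> measurable B ->
    pr j (A `*` B) = eta j A * theta j B by exact: product_measure1E.
have prK j : (j < N.+1)%N -> pr j (K1 `*` K2) = 1.
  move=> jN; rewrite prX// (split_full_measure etaP)// (split_full_measure thetaP)//.
  by rewrite mul1e.
have mK : measurable (K1 `*` K2 : set (borel Y * borel Y)) by exact: measurableX.
have prphi j (h : borel (Y * Y)%type -> borel Y) (h' : borel Y * borel Y -> borel Y)
    (B : set (borel Y)) : (j < N.+1)%N -> measurable B ->
    measurable_fun setT h -> measurable_fun setT h' ->
    (forall u v, h (u, v) = h' (u, v)) ->
    mimage (pr j) (mphi j) (h @^-1` B) = pr j (h' @^-1` B).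
  move=> jN mB mh mh' hh'; apply: (probability_eq_on mK (prK j jN)).
  - rewrite -[X in measurable X]setTI; apply: (mphi j) => //.
    by rewrite -[X in measurable X]setTI; apply: mh.
  - by rewrite -[X in measurable X]setTI; apply: mh'.
  - apply/seteqP; split => -[u v] [/= Buv K12]; split => //;
      by move: Buv; rewrite /preimage/= /retract mem_set//= hh'.
have m1 := measurable_fst (T1 := borel Y) (T2 := borel Y).
have m2 := measurable_snd (T1 := borel Y) (T2 := borel Y).
exists gamma.
  move=> B mB; split; rewrite /gamma /= averageE.
  - rewrite etaP// averageE; congr (_ * _); apply: eq_bigr => j _; apply/esym.
    transitivity (mimage (pr j) (mphi j) (fst @^-1` B)); last by [].
    rewrite (prphi j fst fst B (ltn_ord j) mB (@measurable_borel_fst R Y))//.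
    have -> : fst @^-1` B = B `*` setT :> set (borel Y * borel Y).
      by apply/seteqP; split => -[u v] //= [].
    by rewrite prX// [X in _ * X](@probability_setT _ _ _ (theta j)) mule1.
  - rewrite thetaP// averageE; congr (_ * _); apply: eq_bigr => j _; apply/esym.
    transitivity (mimage (pr j) (mphi j) (snd @^-1` B)); last by [].
    rewrite (prphi j snd snd B (ltn_ord j) mB (@measurable_borel_snd R Y))//.
    have -> : snd @^-1` B = setT `*` B :> set (borel Y * borel Y).
      by apply/seteqP; split => -[u v] //= [].
    by rewrite prX// [X in X * _](@probability_setT _ _ _ (eta j)) mul1e.
have [c1 [c2 [c10 c20 cE cT]]] := dpow_triangle Y p1 a0 b0.
have md1 j := @measurable_dpow1 R p Y (x j).
have md2 := @measurable_dpow2 R p Y.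
have d0 y z : 0 <= dpow p y z :> \bar R by exact: dpow_ge0.
have md11 j : measurable_fun setT
    (fun z : borel Y * borel Y => dpow p (x j) z.1).
  exact: (measurableT_comp (md1 j) m1).
have md12 j : measurable_fun setT
    (fun z : borel Y * borel Y => dpow p (x j) z.2).
  exact: (measurableT_comp (md1 j) m2).
have i1 j : \int[pr j]_z dpow p (x j) z.1 = \int[eta j]_y dpow p (x j) y.
  rewrite -(ge0_integral_mimage m1 (pr j) (md1 j))//.
  apply: eq_measure_integral => A mA _; rewrite /= /mimage /pushforward.
  have -> : fst @^-1` A = A `*` setT :> set (borel Y * borel Y).
    by apply/seteqP; split => -[u v] //= [].
  by rewrite prX// [X in _ * X](@probability_setT _ _ _ (theta j)) mule1.
have i2 j : \int[pr j]_z dpow p (x j) z.2 = \int[theta j]_y dpow p (x j) y.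
  rewrite -(ge0_integral_mimage m2 (pr j) (md1 j))//.
  apply: eq_measure_integral => A mA _; rewrite /= /mimage /pushforward.
  have -> : snd @^-1` A = setT `*` A :> set (borel Y * borel Y).
    by apply/seteqP; split => -[u v] //= [].
  by rewrite prX// [X in X * _](@probability_setT _ _ _ (eta j)) mul1e.
apply: (@le_trans _ _
    (c1%:E * splitcost p N x eta + c2%:E * splitcost p N x theta)).
  rewrite /cost ge0_integral_average//; last by move=> z; exact: d0.
  rewrite /splitcost !(muleCA _ (N.+1%:R^-1)%:E) -ge0_muleDr; last 2 first.
  - by rewrite mule_ge0// sume_ge0// => j _; exact: integral_ge0.
  - by rewrite mule_ge0// sume_ge0// => j _; exact: integral_ge0.
  apply: lee_pmul => //.
    by apply: sume_ge0 => j _; apply: integral_ge0 => z _; exact: d0.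
  rewrite ge0_sume_distrr; last by move=> j _; exact: integral_ge0.
  rewrite ge0_sume_distrr; last by move=> j _; exact: integral_ge0.
  rewrite -big_split/=; apply: lee_sum => j _.
  rewrite ge0_integral_mimage//; last by move=> z; exact: d0.
  rewrite -i1 -i2.
  rewrite -!ge0_integralZl//.
  rewrite -ge0_integralD//; last 4 first.
  - by move=> z _; rewrite mule_ge0.
  - exact: measurable_funeM.
  - by move=> z _; rewrite mule_ge0.
  - exact: measurable_funeM.
  apply: ge0_le_integral => //.
  - by move=> z _; exact: d0.
  - exact: (measurableT_comp md2 (mphi j)).
  - by apply: emeasurable_funD; exact: measurable_funeM.
  - move=> [u v] _; rewrite /retract; case: ifPn => _ /=.
      by rewrite (dpow_sym p (x j) u); exact: cT.
    rewrite /dpow mdistxx powR0 ?gt_eqF// ?(lt_le_trans _ p1)//.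
    by rewrite adde_ge0// mule_ge0 ?lee_fin ?powR_ge0.
rewrite -cE EFinD !EFinM; apply: leeD; exact: lee_wpmul2l.
Qed.

End product_coupling.

(** * The triangle inequality through empirical measures *)

Section wasserstein_triangle.
Variables (R : realType) (p : R) (Y : pmetricType R).
Hypothesis p1 : 1 <= p.
Local Open Scope ereal_scope.

Let p0 : (0 < p)%R. Proof. by rewrite (lt_le_trans _ p1). Qed.

Lemma moment_lty (mu : probability (borel Y) R) (y : Y) : finite_moment p mu ->
  \int[mu]_z dpow p y z < +oo.
Proof.
move=> [x0 x0oo].
have [c1 [c2 [c10 c20 _ cT]]] := dpow_triangle Y p1 (@ltr01 R) (@ltr01 R).
have md z := @measurable_dpow1 R p Y z.
have d0 z z' : 0 <= dpow p z z' :> \bar R by exact: dpow_ge0.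
apply: (@le_lt_trans _ _
    (\int[mu]_z (c1%:E * dpow p y x0 + c2%:E * dpow p x0 z))).
  apply: ge0_le_integral => //.
  - by apply: emeasurable_funD => //; exact: measurable_funeM.
rewrite ge0_integralD//; last 3 first.
- by move=> z _; rewrite mule_ge0.
- by move=> z _; rewrite mule_ge0.
- exact: measurable_funeM.
rewrite integral_cst// ge0_integralZl// lte_add_pinfty//.
  by rewrite [X in _ * X](@probability_setT _ _ _ mu) mule1 ltry.
by rewrite lte_mul_pinfty.
Qed.

(** Two measures, each regarded as a single piece over the same point, are
    coupled independently. *)
Lemma ex_coupling_lty (mu nu : Pp p Y) :
  exists2 gamma, coupling (sval mu) (sval nu) gamma & cost p gamma < +oo.
Proof.
have big (la : probability (borel Y) R) : finite_moment p la ->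
    exists2 a : R, (0 < a)%R &
    splitcost p 0 (fun=> point) (fun=> la) <= (a `^ p)%:E.
  move=> fm; have := moment_lty (@point Y) fm.
  have : 0 <= \int[la]_z dpow p point z.
    by apply: integral_ge0 => z _; exact: dpow_ge0.
  have -> : splitcost p 0 (fun=> point) (fun=> la) = \int[la]_z dpow p point z.
    by rewrite /splitcost big_ord1 invr1 mul1e.
  case: (\int[la]_z _) => // m m0 _; rewrite lee_fin in m0.
  exists (m + 1)%R; first by rewrite ltr_wpDl.
  by rewrite lee_fin (le_trans _ (le1r_powR _ _))// ?lerDl// ?lerDr.
have spl (la : probability (borel Y) R) : splits 0 (fun=> la) la.
  by move=> B mB; rewrite averageE big_ord1 invr1 mul1e.
case: mu nu => [mu [rmu fmu]] [nu [rnu fnu]] /=.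
have [a a0 ca] := big _ fmu; have [b b0 cb] := big _ fnu.
have [g gP gc] := coupling_of_splits p1 a0 b0 rmu rnu (spl mu) ca (spl nu) cb.
by exists g => //; rewrite (le_lt_trans gc)// ltry.
Qed.

Lemma Wp_lt_coupling (mu nu : Pp p Y) (a : R) : (Wp mu nu < a)%R ->
  exists2 gamma, coupling (sval mu) (sval nu) gamma & cost p gamma < (a `^ p)%:E.
Proof. by apply: coupling_of_Wp_lt => //; exact: ex_coupling_lty. Qed.

Lemma Wp_lt_split N (x : nat -> Y) (mu : Pp p Y) (a : R) :
  (Wp (empirical_Pp p N x) mu < a)%R ->
  exists2 eta, splits N eta (sval mu) & splitcost p N x eta < (a `^ p)%:E.
Proof.
move=> /Wp_lt_coupling[g /split_of_coupling-/(_ p)[eta etaP <-] ?].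
by exists eta.
Qed.

Lemma Wp_le_split N (x : nat -> Y) (mu : Pp p Y) eta (a : R) : (0 <= a)%R ->
  splits N eta (sval mu) -> splitcost p N x eta <= (a `^ p)%:E ->
  (Wp (empirical_Pp p N x) mu <= a)%R.
Proof.
move=> a0 /(coupling_of_split p x)[g gP <-].
exact: (@Wp_le_of_cost R p Y p1 (empirical_Pp p N x) mu g a a0 gP).
Qed.

Let le_add_of_lt (u v w : R) :
  (forall a b, u < a -> v < b -> w <= a + b)%R -> (w <= u + v)%R.
Proof.
move=> h; apply/ler_addgt0Pl => e e0.
have -> : (e + (u + v) = (u + e / 2) + (v + e / 2))%R by lra.
by apply: h; rewrite ltrDl divr_gt0.
Qed.

Lemma Wp_triangle_empirical_end N (x : nat -> Y) (mu nu : Pp p Y) :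
  (Wp (empirical_Pp p N x) nu <= Wp (empirical_Pp p N x) mu + Wp mu nu)%R.
Proof.
apply: le_add_of_lt => a b ua vb.
have a0 : (0 < a)%R by rewrite (le_lt_trans _ ua)// Wp_ge0.
have b0 : (0 < b)%R by rewrite (le_lt_trans _ vb)// Wp_ge0.
have [eta etaP /ltW etac] := Wp_lt_split ua.
have [g gP /ltW gc] := Wp_lt_coupling vb.
have [eta' eta'P eta'c] := split_trans p1 a0 b0 etaP etac gP gc.
by apply: (Wp_le_split _ eta'P eta'c); rewrite addr_ge0// ltW.
Qed.

Lemma Wp_triangle_empirical_mid N (x : nat -> Y) (mu nu : Pp p Y) :
  (Wp mu nu <= Wp mu (empirical_Pp p N x) + Wp (empirical_Pp p N x) nu)%R.
Proof.
rewrite (Wp_sym mu (empirical_Pp p N x)).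
apply: le_add_of_lt => a b ua vb.
have a0 : (0 < a)%R by rewrite (le_lt_trans _ ua)// Wp_ge0.
have b0 : (0 < b)%R by rewrite (le_lt_trans _ vb)// Wp_ge0.
have [eta etaP /ltW etac] := Wp_lt_split ua.
have [theta thetaP /ltW thetac] := Wp_lt_split vb.
have [g gP gc] := coupling_of_splits p1 a0 b0 (svalP mu).1 (svalP nu).1
  etaP etac thetaP thetac.
by apply: (@Wp_le_of_cost R p Y p1 mu nu g _ _ gP gc); rewrite addr_ge0// ltW.
Qed.

End wasserstein_triangle.

(** * Transport plans between empirical measures *)

Section transport_plans.
Variables (R : realType) (p : R).
Hypothesis p1 : 1 <= p.
Local Open Scope ereal_scope.

Definition plan N M (pi : nat -> nat -> R) : Prop :=
  [/\ forall j k, (0 <= pi j k)%R,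
      forall j, (j < N.+1)%N -> (\sum_(k < M.+1) pi j k = N.+1%:R^-1)%R &
      forall k, (k < M.+1)%N -> (\sum_(j < N.+1) pi j k = M.+1%:R^-1)%R].

(** The mass that the [j]-th piece has at [y k] is shared evenly between the
    indices [k] of this atom. *)
Lemma Wp_lt_plan (Y : pmetricType R) N M (x y : nat -> Y) (a : R) :
  (Wp (empirical_Pp p N x) (empirical_Pp p M y) < a)%R ->
  exists2 pi, plan N M pi &
    (\sum_(j < N.+1) \sum_(k < M.+1) pi j k * mdist (x j) (y k) `^ p
      < a `^ p)%R.
Proof.
move=> /(Wp_lt_split p1)[eta etaP etac].
have [g [mg g0 g1 gmean gy]] := atom_densities M y.
have gmean' j : (j < N.+1)%N -> {ae eta j, forall z,
    ((M.+1%:R)^-1)%R%:E * \sum_(k < M.+1) g k z = 1}.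
  move=> jN; have [A [mA A0 sub]] := gmean; exists A; split => //.
  exact: split_null etaP jN mA A0.
have d0 z z' : 0 <= dpow p z z' :> \bar R by exact: dpow_ge0.
have mean_int j (f : borel Y -> \bar R) : (j < N.+1)%N ->
    measurable_fun setT f -> (forall z, 0 <= f z) ->
    ((M.+1%:R)^-1)%R%:E * \sum_(k < M.+1) \int[eta j]_z (f z * g k z) =
    \int[eta j]_z f z.
  by move=> jN mf f0; apply: mean_weighted_integral => //; exact: gmean'.
pose q j k : \bar R := if (j < N.+1)%N && (k < M.+1)%N then
  \int[eta j]_z g k z else 0.
have qE j k : (j < N.+1)%N -> (k < M.+1)%N -> q j k = \int[eta j]_z g k z.
  by rewrite /q => -> ->.
have q0 j k : 0 <= q j k.
  by rewrite /q; case: ifP => // _; exact: integral_ge0.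
have qrow j : (j < N.+1)%N ->
    ((M.+1%:R)^-1)%R%:E * \sum_(k < M.+1) q j k = 1.
  move=> jN; rewrite -[RHS](probability_setT (eta j)).
  rewrite -[RHS]mul1e -[RHS]integral_cst// -(mean_int j (cst 1))//.
  congr (_ * _); apply: eq_bigr => k _; rewrite qE//.
  by apply: eq_integral => z _; rewrite mul1e.
have qcol k : (k < M.+1)%N ->
    ((N.+1%:R)^-1)%R%:E * \sum_(j < N.+1) q j k = 1.
  move=> kM; rewrite -(g1 k kM) (splits_ge0_integral etaP)//.
  by congr (_ * _); apply: eq_bigr => j _; rewrite qE.
have qfin j k : q j k \is a fin_num.
  rewrite ge0_fin_numE//.
  have [/andP[jN kM]|/negPf jk] := boolP ((j < N.+1)%N && (k < M.+1)%N); last first.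
    by rewrite /q jk ltry.
  have := qrow _ jN; rewrite (bigD1 (Ordinal kM))//=.
  rewrite ltey; case: (q j k) (q0 j k) => // _.
  rewrite addye; last by rewrite gt_eqF// (lt_le_trans ltNy0)// sume_ge0.
  by rewrite gt0_muley// lte_fin invr_gt0.
pose pi j k : R := (N.+1%:R^-1 * M.+1%:R^-1 * fine (q j k))%R.
exists pi.
  split => [j k|j jN|k kM].
  - by rewrite !mulr_ge0// fine_ge0.
  - apply/EFin_inj; rewrite -sumEFin.
    rewrite (eq_bigr (fun k : 'I_M.+1 =>
      (N.+1%:R^-1)%:E * ((M.+1%:R^-1)%:E * q j k))); last first.
      by move=> k _; rewrite /pi !EFinM fineK// muleA.
    rewrite -ge0_sume_distrr; last by move=> k _; rewrite mule_ge0.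
    by rewrite -ge0_sume_distrr// qrow// mule1.
  - apply/EFin_inj; rewrite -sumEFin.
    rewrite (eq_bigr (fun j : 'I_N.+1 =>
      (M.+1%:R^-1)%:E * ((N.+1%:R^-1)%:E * q j k))); last first.
      by move=> j _; rewrite /pi !EFinM fineK// muleCA muleA.
    rewrite -ge0_sume_distrr; last by move=> j _; rewrite mule_ge0.
    by rewrite -ge0_sume_distrr// qcol// mule1.
rewrite -lte_fin; apply: le_lt_trans etac.
rewrite -sumEFin /splitcost ge0_sume_distrr; last first.
  by move=> j _; apply: integral_ge0 => z _; exact: d0.
apply: lee_sum => j _.
rewrite -(mean_int j (fun z => dpow p (x j) z))//; last exact: measurable_dpow1.
rewrite -sumEFin ge0_sume_distrr; last first.
  by move=> k _; apply: integral_ge0 => z _; rewrite mule_ge0.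
rewrite ge0_sume_distrr; last first.
  by move=> k _; rewrite mule_ge0//; apply: integral_ge0 => z _; rewrite mule_ge0.
apply: lee_sum => k _.
have -> : \int[eta j]_z (dpow p (x j) z * g k z) = dpow p (x j) (y k) * q j k.
  transitivity (\int[eta j]_z (dpow p (x j) (y k) * g k z)).
    by apply: eq_integral => z _; have [->|->] := gy k z; rewrite ?mule0.
  rewrite (qE _ _ (ltn_ord j) (ltn_ord k)).
  by apply: ge0_integralZl => //; exact: mg.
by rewrite /pi !EFinM fineK// -!muleA (muleC (q j k)).
Qed.

Lemma Wp_le_plan (Y : pmetricType R) N M (x y : nat -> Y) pi (a : R) :
  (0 <= a)%R -> plan N M pi ->
  (\sum_(j < N.+1) \sum_(k < M.+1) pi j k * mdist (x j) (y k) `^ p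
    <= a `^ p)%R ->
  (Wp (empirical_Pp p N x) (empirical_Pp p M y) <= a)%R.
Proof.
move=> a0 [pi0 row col] cpi.
have dT (z : Y) : \d_(z : borel Y) setT = 1 :> \bar R by rewrite diracT.
pose m j : {measure set (borel Y) -> \bar R} :=
  msum (fun k => mscale (NngNum (pi0 j k)) (\d_(y k : borel Y))) M.+1.
have mE j B : m j B = \sum_(k < M.+1) (pi j k)%:E * \d_(y k : borel Y) B by [].
have [||g gP gc] := @coupling_of_pieces R Y p N.+1 m x
  (empirical R N (x : nat -> borel Y)) (empirical R M (y : nat -> borel Y)).
- move=> B mB /=; rewrite empiricalE ge0_sume_distrr//.
  apply: eq_bigr => j _; congr (_ * _); rewrite mE.
  rewrite (eq_bigr (fun k : 'I_M.+1 => (pi j k)%:E)).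
    by rewrite sumEFin row.
  by move=> k _; rewrite dT mule1.
- move=> B mB /=; rewrite empiricalE ge0_sume_distrr//.
  rewrite [RHS](eq_bigr (fun j : 'I_N.+1 =>
    \sum_(k < M.+1) (pi j k)%:E * \d_(y k : borel Y) B))//.
  rewrite exchange_big/=; apply: eq_bigr => k _.
  by rewrite -ge0_sume_distrl ?sumEFin ?col// => j _; rewrite lee_fin.
apply: (@Wp_le_of_cost R p Y p1 (empirical_Pp p N x) (empirical_Pp p M y) g a a0 gP).
rewrite gc.
apply: le_trans (_ : (\sum_(j < N.+1) \sum_(k < M.+1)
  pi j k * mdist (x j) (y k) `^ p)%R%:E <= _); last by rewrite lee_fin.
rewrite -sumEFin; apply: lee_sum => j _; rewrite -sumEFin.
rewrite ge0_integral_measure_sum//; last 2 first.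
- by move=> z _; exact: dpow_ge0.
- exact: measurable_dpow1.
apply: lee_sum => k _; rewrite ge0_integral_mscale//; last 2 first.
- exact: measurable_dpow1.
- by move=> z _; exact: dpow_ge0.
rewrite integral_dirac//; last exact: measurable_dpow1.
by rewrite diracT mul1e EFinM.
Qed.

End transport_plans.

(** * Rounding weights and transporting cells *)

Section labels.
Variable R : realType.

Definition freq N (l : nat -> nat) (j : nat) : R :=
  N.+1%:R^-1 * \sum_(k < N.+1) (l k == j)%:R.

Lemma freq_ge0 N l j : 0 <= freq N l j.
Proof. by rewrite mulr_ge0// sumr_ge0. Qed.

Lemma sum_freq N n l : (forall k, (l k < n)%N) ->
  \sum_(j < n) freq N l j = 1.
Proof.
move=> ln; rewrite -mulr_sumr exchange_big/=.
rewrite (eq_bigr (fun=> 1)) => [|k _].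
  by rewrite sumr_const card_ord mulVf// pnatr_eq0.
rewrite (bigD1 (Ordinal (ln k)))//= eqxx big1 ?addr0// => j.
by rewrite -val_eqE/= eq_sym => /negPf ->.
Qed.

Lemma ex_lt_nat (t : R) : 0 <= t ->
  exists c : nat, (c = 0%N \/ c%:R < t) /\ t <= c.+1%:R.
Proof.
move=> t0; have ex : exists m : nat, t <= m%:R.
  by exists (Num.trunc t).+1; exact/ltW/truncnS_gt.
case: (ex_minnP ex) => -[|c] tc minc.
  by exists 0%N; split; [left|rewrite (le_trans tc)].
exists c; split => //; right; rewrite ltNge; apply/negP => /minc.
by rewrite ltnn.
Qed.

(** Frequencies can be kept strictly below the prescribed weights, the excess
    being collected under the label 0: strictness survives a passage to
    nearby weights. *)
Lemma ex_labels n (w : nat -> R) (e : R) : 0 < e -> (forall j, 0 <= w j) ->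
  \sum_(j < n.+1) w j = 1 ->
  exists N l, [/\ forall k, (l k < n.+1)%N,
    forall j, (0 < j < n.+1)%N -> freq N l j = 0 \/ freq N l j < w j &
    freq N l 0 <= w 0%N + e].
Proof.
move=> e0 w0 w1.
(* Rounding loses less than [1 / (N + 1)] for each of the [n] labels. *)
have [N Ne] : exists N : nat, n%:R <= e * N.+1%:R.
  exists (Num.trunc (n%:R / e)); rewrite mulrC -ler_pdivrMr//.
  exact/ltW/truncnS_gt.
have N0 : 0 < N.+1%:R :> R by [].
have [c cP] := choice (fun j => ex_lt_nat (mulr_ge0 (ler0n R N.+1) (w0 j))).
have cw j : (c j)%:R <= N.+1%:R * w j.
  by have [[->|/ltW//] _] := cP j; rewrite mulr_ge0.
pose s := flatten [seq nseq (c j) j | j <- iota 1 n].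
have size_s : size s = \sum_(j < n) c j.+1.
  rewrite size_flatten /shape -map_comp sumnE big_map.
  rewrite (eq_bigr c); last by move=> j _; rewrite /= size_nseq.
  rewrite (_ : iota 1 n = index_iota 1 n.+1); last by rewrite /index_iota subn1.
  by rewrite big_add1/= big_mkord.
have sN : (size s <= N.+1)%N.
  rewrite -(ler_nat R) size_s natr_sum.
  apply: (@le_trans _ _ (\sum_(j < n) N.+1%:R * w j.+1)).
    by apply: ler_sum => j _; exact: cw.
  rewrite -mulr_sumr ler_piMr// -w1 big_ord_recl lerDr.
  exact: w0.
pose s' := s ++ nseq (N.+1 - size s) 0%N.
have size_s' : size s' = N.+1 by rewrite size_cat size_nseq subnKC.
pose l k := nth 0%N s' k.
have ln k : (l k < n.+1)%N.
  rewrite /l; have [kN|Nk] := ltnP k (size s'); last by rewrite nth_default.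
  have := mem_nth 0%N kN; rewrite mem_cat => /orP[|/nseqP[->//]].
  by move=> /flatten_mapP[j]; rewrite mem_iota => /andP[_ ?] /nseqP[->].
have freqE j : (0 < j < n.+1)%N -> freq N l j = N.+1%:R^-1 * (c j)%:R.
  move=> /andP[j0 jn]; congr (_ * _).
  transitivity (\sum_(x <- s') (x == j)%:R : R).
    by rewrite (big_nth 0%N) big_mkord size_s'.
  rewrite -natr_sum -big_mkcond/= sum1_count count_cat count_nseq/=.
  rewrite [(0 == j)%N]eq_sym (gtn_eqF j0) mul0n addn0.
  rewrite count_flatten -map_comp sumnE big_map.
  rewrite (bigD1_seq j)/= ?iota_uniq ?mem_iota ?j0//.
  rewrite count_nseq/= eqxx mul1n big1_seq ?addn0// => i /andP[ij _].
  by rewrite count_nseq/= (negPf ij).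
exists N, l; split => //.
  move=> j jn; rewrite freqE//; have [[->|cj] _] := cP j.
    by left; rewrite mulr0.
  by right; rewrite mulrC ltr_pdivrMr// mulrC.
have := sum_freq N ln; rewrite big_ord_recl/= => f1.
have := w1; rewrite big_ord_recl/= => {}w1.
have : \sum_(j < n) w j.+1 - \sum_(j < n) freq N l j.+1 <= e.
  rewrite -sumrB; apply: (@le_trans _ _ (\sum_(j < n) N.+1%:R^-1)).
    apply: ler_sum => j _; rewrite freqE/= ?ltnS//.
    rewrite lerBlDl -[X in _ + X]mulr1 -mulrDr natr1 ler_pdivlMl//.
    by have [_] := cP j.+1.
  rewrite sumr_const card_ord -[X in X <= _]mulr_natl.
  by rewrite ler_pdivrMr.
by rewrite /bump/= in f1 w1 *; lra.
Qed.

End labels.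

Section cells.
Variables (R : realType) (p : R) (Y : pmetricType R).
Hypothesis p1 : 1 <= p.
Local Open Scope ereal_scope.

Let p0 : (0 < p)%R. Proof. by rewrite (lt_le_trans _ p1). Qed.

Lemma measurable_mdist_gt (x : Y) (r : R) :
  measurable ([set y | (r < mdist x y)%R] : set (borel Y)).
Proof.
have := @measurable_mdist1 R Y x measurableT `]r, +oo[%classic (measurable_itv _).
rewrite setTI; congr measurable; apply/seteqP.
by split => y /=; rewrite in_itv/= andbT.
Qed.

Lemma integral_dpow_le (m : {measure set (borel Y) -> \bar R}) (x : Y) (r : R) :
  m [set y | (r < mdist x y)%R] = 0 ->
  \int[m]_y dpow p x y <= (r `^ p)%:E * m setT.
Proof.
move=> m0; rewrite -integral_cst//; apply: ae_ge0_le_integral => //.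
- by move=> y _; exact: dpow_ge0.
- exact: measurable_dpow1.
- by move=> y _; rewrite lee_fin powR_ge0.
exists [set y | (r < mdist x y)%R]; split => //; first exact: measurable_mdist_gt.
move=> y /=; apply: contra_notP => /negP; rewrite -leNgt => yr _.
rewrite lee_fin ge0_ler_powR// ?nnegrE ?mdist_ge0//; first exact: ltW.
by rewrite (le_trans _ yr)// mdist_ge0.
Qed.

Lemma empirical_freq N n (l : nat -> nat) (x : nat -> Y) (B : set (borel Y)) :
  (forall k, (l k < n)%N) ->
  empirical R N (fun k => x (l k) : borel Y) B =
  \sum_(j < n) (freq R N l j)%:E * \d_(x j : borel Y) B.
Proof.
move=> ln; rewrite empiricalE.
rewrite (eq_bigr (fun k : 'I_N.+1 => \sum_(j < n)
  ((l k == j)%:R)%:E * \d_(x j : borel Y) B)); last first.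
  move=> k _; rewrite (bigD1 (Ordinal (ln k)))//= eqxx mul1e big1 ?adde0// => j.
  by rewrite -val_eqE/= eq_sym => /negPf ->; rewrite mul0e.
rewrite exchange_big/= ge0_sume_distrr; last first.
  by move=> j _; apply: sume_ge0 => k _; rewrite mule_ge0// lee_fin.
apply: eq_bigr => j _; rewrite -ge0_sume_distrl; last first.
  by move=> k _; rewrite lee_fin.
by rewrite muleA sumEFin -EFinM.
Qed.

(** Each cell sends to its own point as much mass as the label frequency
    requires, over a distance at most [r], and the excess to [x 0], over a
    distance at most [D]. *)
Lemma Wp_le_cells (nu : Pp p Y) n (m : nat -> {measure set (borel Y) -> \bar R})
    (x : nat -> Y) N l (r D d e : R) :
  (forall B : set (borel Y), measurable B -> sval nu B = \sum_(j < n.+1) m j B) ->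
  (forall j, (j < n.+1)%N -> m j [set y | (D < mdist (x 0%N) y)%R] = 0) ->
  (forall j, (0 < j < n.+1)%N -> m j [set y | (r < mdist (x j) y)%R] = 0) ->
  (forall k, (l k < n.+1)%N) ->
  (forall j, (0 < j < n.+1)%N -> (freq R N l j)%:E <= m j setT) ->
  (freq R N l 0 <= d)%R -> (r `^ p + D `^ p * d <= e `^ p)%R -> (0 <= e)%R ->
  (Wp (empirical_Pp p N (fun k => x (l k))) nu <= e)%R.
Proof.
move=> nuE mD mr ln lm l0 rDe e0.
have mfin j : (j < n.+1)%N -> m j setT \is a fin_num.
  move=> jn; rewrite ge0_fin_numE// (@le_lt_trans _ _ 1)// ?ltry//.
  rewrite -(probability_setT (sval nu)) nuE// (bigD1 (Ordinal jn))//=.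
  by rewrite leeDl// sume_ge0.
pose t j : R := if (0 < j < n.+1)%N then (freq R N l j / fine (m j setT))%R else 0%R.
have t0 j : (0 <= t j)%R.
  by rewrite /t; case: ifP => // _; rewrite divr_ge0 ?freq_ge0// fine_ge0.
have t1 j : (0 <= 1 - t j)%R.
  rewrite /t; case: ifPn => [jn|]; last by rewrite subr0.
  have jn' : (j < n.+1)%N by case/andP: jn.
  rewrite subr_ge0; have := lm _ jn; rewrite -(fineK (mfin _ jn')) lee_fin => fm.
  have := le_trans (freq_ge0 R N l j) fm; rewrite le_eqVlt => /predU1P[<-|m0].
    by rewrite invr0 mulr0.
  by rewrite ler_pdivrMr// mul1r.
have tm j : (0 < j < n.+1)%N -> (t j)%:E * m j setT = (freq R N l j)%:E.
  move=> jn; have jn' : (j < n.+1)%N by case/andP: jn.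
  have := lm _ jn; rewrite -(fineK (mfin _ jn')) lee_fin -EFinM => fm.
  have := le_trans (freq_ge0 R N l j) fm; rewrite le_eqVlt => /predU1P[m0|m0].
    rewrite -m0 mulr0; congr EFin; apply/eqP; rewrite eq_le freq_ge0/=.
    by rewrite [leRHS]m0.
  by rewrite /t jn divfK// gt_eqF.
pose rest : {measure set (borel Y) -> \bar R} :=
  msum (fun j => mscale (NngNum (t1 j)) (m j)) n.+1.
pose m' j : {measure set (borel Y) -> \bar R} :=
  if j == 0%N then rest else mscale (NngNum (t0 j)) (m j).
have restE B : rest B = \sum_(j < n.+1) (1 - t j)%:E * m j B by [].
have m'0 B : m' 0%N B = rest B by [].
have m'S j B : m' j.+1 B = (t j.+1)%:E * m j.+1 B by [].
have t00 : t 0%N = 0%R by [].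
have sum_m' (B : set (borel Y)) : measurable B ->
    \sum_(j < n.+1) m' j B = sval nu B.
  move=> mB; rewrite nuE// big_ord_recl m'0 restE.
  rewrite (eq_bigr (fun j : 'I_n => (t (bump 0 j))%:E * m (bump 0 j) B)); last first.
    by move=> j _; rewrite /= m'S.
  have -> : \sum_(j < n) (t (bump 0 j))%:E * m (bump 0 j) B =
      \sum_(j < n.+1) (t j)%:E * m j B.
    by rewrite [RHS]big_ord_recl/= t00 mul0e add0e.
  rewrite -big_split/=; apply: eq_bigr => j _.
  by rewrite -ge0_muleDl ?lee_fin// -EFinD subrK mul1e.
have m'T j : (j < n.+1)%N -> m' j setT = (freq R N l j)%:E.
  case: j => [_|j jn]; last by rewrite m'S tm.
  have := sum_m' _ measurableT; rewrite probability_setT big_ord_recl.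
  rewrite (eq_bigr (fun j : 'I_n => (freq R N l (bump 0 j))%:E)); last first.
    by move=> j _; rewrite m'S tm//= ltnS.
  have := congr1 EFin (@sum_freq R N n.+1 l ln).
  rewrite -sumEFin big_ord_recl => <-; rewrite sumEFin.
  by move=> /(congr1 (fun z => z - (\sum_(j < n) freq R N l (bump 0 j))%:E));
    rewrite !addeK.
have [||g gP gc] := @coupling_of_pieces R Y p n.+1 m' x
  (empirical R N (fun k => x (l k) : borel Y)) (sval nu).
- move=> B mB /=; rewrite (empirical_freq _ _ _ ln).
  by apply: eq_bigr => j _; rewrite m'T.
- by move=> B mB; rewrite sum_m'.
apply: (@Wp_le_of_cost R p Y p1 (empirical_Pp p N (fun k => x (l k))) nu g e e0 gP).
rewrite gc big_ord_recl; apply: le_trans (_ : (D `^ p * d + r `^ p)%R%:E <= _);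
  last by rewrite lee_fin addrC.
rewrite EFinD; apply: leeD.
  apply: (@le_trans _ _ ((D `^ p)%:E * m' 0%N setT)).
    apply: (@integral_dpow_le (m' 0%N) (x 0%N) D); rewrite m'0 restE big1// => j _.
    by rewrite [X in _ * X](mD _ (ltn_ord j)) mule0.
  by rewrite m'T// -EFinM lee_fin ler_wpM2l// powR_ge0.
apply: (@le_trans _ _ (\sum_(j < n) (r `^ p * freq R N l (bump 0 j))%:E)).
  apply: lee_sum => j _.
  apply: (@le_trans _ _ ((r `^ p)%:E * m' (bump 0 j) setT)).
    apply: (@integral_dpow_le (m' (bump 0 j)) (x (bump 0 j)) r).
    by rewrite m'S [X in _ * X]mr ?mule0//= ltnS.
  by rewrite m'T//= ltnS.
rewrite sumEFin lee_fin -mulr_sumr ler_piMr ?powR_ge0//.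
by rewrite -(@sum_freq R N n.+1 l ln) [leRHS]big_ord_recl lerDr freq_ge0.
Qed.

End cells.

(** * Standard parts and internal sets *)

Section standard_part.
Variables (R : realType) (omega : npultrafilter).
Implicit Types a b : nat -> R.

Lemma ultra_limit_unique a r s :
  (forall eps, 0 < eps -> omega [set i | `|a i - r| < eps]) ->
  (forall eps, 0 < eps -> omega [set i | `|a i - s| < eps]) -> r = s.
Proof.
move=> ar as_; apply/eqP; apply: contraT => rs.
have e0 : 0 < `|r - s| / 2 by rewrite divr_gt0// normr_gt0 subr_eq0.
have [i [/= h1 h2]] := filter_ex (filterI (ar _ e0) (as_ _ e0)).
have := ler_distD (a i) r s; rewrite (distrC r (a i)).
by move: h1 h2; move: `|a i - r| `|a i - s| `|r - s| => u v w; lra.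
Qed.

Lemma hst_eq a r :
  (forall eps, 0 < eps -> omega [set i | `|a i - r| < eps]) ->
  hst (uclass omega a) = r.
Proof.
move=> ar; apply: (ultra_limit_unique _ ar).
have : happrox (uclass omega a) (hstd omega r) by exact/happroxE.
move=> har; apply/happroxE.
exact: (@xgetPex R 0 [set s | happrox (uclass omega a) (hstd omega s)]
  (ex_intro _ r har)).
Qed.

Lemma hst_approx a M eps : omega [set i | `|a i| <= M] -> 0 < eps ->
  omega [set i | `|a i - hst (uclass omega a)| < eps].
Proof.
move=> aM; have fa : hfinite (uclass omega a).
  apply/hfiniteE; exists (M + 1); apply: filterS aM => i /= aiM.
  by rewrite (le_lt_trans aiM)// ltrDl.
exact: (iffLR (happroxE _ _ _) (hfinite_st fa)).
Qed.

Lemma hst_ge a M c : omega [set i | `|a i| <= M] ->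
  omega [set i | c <= a i] -> c <= hst (uclass omega a).
Proof.
move=> aM ca; apply/ler_addgt0Pl => eps eps0.
have [i [/= h1]] := filter_ex (filterI ca (hst_approx aM eps0)).
by rewrite ltr_norml => /andP[_ h2]; lra.
Qed.

Lemma hst_le a M c : omega [set i | `|a i| <= M] ->
  omega [set i | a i <= c] -> hst (uclass omega a) <= c.
Proof.
move=> aM ca; apply/ler_addgt0Pl => eps eps0.
have [i [/= h1]] := filter_ex (filterI ca (hst_approx aM eps0)).
by rewrite ltr_norml => /andP[h2 _]; lra.
Qed.

Lemma hstD a b M N : omega [set i | `|a i| <= M] -> omega [set i | `|b i| <= N] ->
  hst (uclass omega (fun i => a i + b i)) =
  hst (uclass omega a) + hst (uclass omega b).
Proof.
move=> aM bN; apply: hst_eq => eps eps0.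
have e2 : 0 < eps / 2 by rewrite divr_gt0.
apply: filterS2 (hst_approx aM e2) (hst_approx bN e2) => i /= h1 h2.
rewrite opprD addrACA (le_lt_trans (ler_normD _ _))//.
by rewrite [ltRHS]splitr ltrD.
Qed.

End standard_part.

Section internal_sets.
Variables (R : realType) (omega : npultrafilter) (X : nat -> pmetricType R).
Implicit Types B : forall i, set (X i).

Lemma internal_uclass B (x : forall i, X i) :
  internal (omega := omega) B (uclass omega x) <-> omega [set i | B i (x i)].
Proof.
have := urepr_uclass omega x; rewrite /internal /= => rx; split => h.
  by apply: filterS2 rx h => i /= ->.
by apply: filterS2 rx h => i /= ->.
Qed.

(** Points chosen in the symmetric differences would form an element of exactly
    one of the two internal sets. *)
Lemma internal_inj B B' : internal (omega := omega) B = internal B' ->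
  omega [set i | B i = B' i].
Proof.
move=> BB'.
have [//|nBB'] := in_ultra_setVsetC [set i | B i = B' i] (ufilter_ultra omega).
have ex i : exists x : X i, B i <> B' i ->
    (B i x /\ ~ B' i x) \/ (~ B i x /\ B' i x).
  have [BiB'|nBiB'] := pselect (B i = B' i); first by exists point.
  apply/not_existsP => h; apply: nBiB'; apply/seteqP; split => x Bx;
    apply: contrapT => nx; apply: (h x) => _; [by left|by right].
pose x i := sval (cid (ex i)); have xP i := svalP (cid (ex i)).
have xS : omega [set i | (B i (x i) /\ ~ B' i (x i)) \/ (~ B i (x i) /\ B' i (x i))].
  by apply: filterS nBB' => i; exact: xP.
have E : omega [set i | B i (x i)] <-> omega [set i | B' i (x i)].
  by rewrite -!internal_uclass BB'.
have [BX|nBX] := in_ultra_setVsetC [set i | B i (x i)] (ufilter_ultra omega).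
  have /= := filter_ex (filterI xS (filterI BX (iffLR E BX))).
  by move=> -[i [/= [[]|[]]]] ? ? [].
have B'X : omega [set i | B' i (x i)].
  by apply: filterS2 xS nBX => i /= [[]|[]].
have /= := filter_ex (filterI nBX (iffRL E B'X)).
by move=> -[i []].
Qed.

Variables (p : R) (mu : Pomega omega p X).

Lemma internal_measureE B : borel_family B ->
  internal_measure mu (internal B) =
  uclass omega (fun i => fine (sval (urepr mu i) (B i))).
Proof.
move=> mB; rewrite /internal_measure; set B0 := xget _ _.
have [mB0 B0E] : borel_family B0 /\ internal B0 = internal (omega := omega) B.
  by rewrite /B0; apply: (@xgetPex _ (fun=> set0) [set B1 | borel_family B1 /\
    internal B1 = internal (omega := omega) B]); exists B.
rewrite -{1}(ureprK mu) umap2E; apply/uclassP.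
by apply: filterS (internal_inj B0E) => i /= ->.
Qed.

Lemma fine_probability_le1 d (T : measurableType d) (P : probability T R) A :
  measurable A -> `|fine (P A)| <= 1.
Proof.
move=> mA; rewrite ger0_norm ?fine_ge0// -lee_fin fineK ?fin_num_measure//.
exact: probability_le1.
Qed.

Lemma internal_bounded B : borel_family B ->
  omega [set i | `|fine (sval (urepr mu i) (B i))| <= 1].
Proof.
move=> mB; apply: filterE => i.
exact: (fine_probability_le1 (sval (urepr mu i)) (mB i)).
Qed.

Lemma loeb_premeasureE B : borel_family B ->
  loeb_premeasure mu (internal B) =
  (hst (uclass omega (fun i => fine (sval (urepr mu i) (B i)))))%:E.
Proof. by move=> mB; rewrite /loeb_premeasure internal_measureE. Qed.

Lemma loeb_premeasure_ge0 A : (0 <= loeb_premeasure mu A)%E.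
Proof.
rewrite lee_fin /internal_measure; set B := xget _ _.
have mB : borel_family B.
  rewrite /B; case: xgetP => [B1 -> []//|_ i]; exact: measurable0.
rewrite -{1}(ureprK mu) umap2E; apply: hst_ge (internal_bounded mB) _.
by apply: filterE => i /=; exact: fine_ge0.
Qed.

Lemma internalU B B' : internal (omega := omega) (fun i => B i `|` B' i) =
  internal B `|` internal B'.
Proof.
apply/seteqP; split => x /=; last first.
  by case; apply: filterS => i /= ?; [left|right].
move=> BB'.
have [|nB] := in_ultra_setVsetC [set i | B i (urepr x i)] (ufilter_ultra omega).
  by left.
by right; apply: filterS2 BB' nB => i /= [].
Qed.

Lemma internalI B B' : internal (omega := omega) (fun i => B i `&` B' i) =
  internal B `&` internal B'.
Proof.
apply/seteqP; split => x /=.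
  by move=> h; split; apply: filterS h => i /= [].
by case=> h1 h2; apply: filterS2 h1 h2 => i.
Qed.

Lemma loeb_premeasureU A A' : internal_borel A -> internal_borel A' ->
  A `&` A' = set0 -> loeb_premeasure mu (A `|` A') =
  (loeb_premeasure mu A + loeb_premeasure mu A')%E.
Proof.
move=> [B mB <-] [B' mB' <-]; rewrite -internalI -internalU => BB'0.
rewrite !loeb_premeasureE//; last by move=> i; exact: measurableU.
rewrite -EFinD -(hstD (internal_bounded mB) (internal_bounded mB')).
congr (hst _)%:E; apply/uclassP.
have : omega [set i | B i `&` B' i = set0].
  apply: (@internal_inj (fun i => B i `&` B' i) (fun=> set0)).
  by rewrite BB'0; apply/seteqP; split => x //= /filter_ex[].
apply: filterS => i /= B0.
rewrite measureU; [|exact: mB|exact: mB'|by []].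
by rewrite fineD//; apply: fin_num_measure; [exact: mB|exact: mB'].
Qed.

Lemma loeb_premeasure0 : loeb_premeasure mu set0 = 0%E.
Proof.
have b0 := internal_borel0 omega X.
have := loeb_premeasureU b0 b0 (set0I _); rewrite setU0 /loeb_premeasure.
by rewrite -EFinD => -[h]; congr EFin; lra.
Qed.

Lemma loeb_premeasure_semi_additive :
  measure_function.semi_additive (loeb_premeasure mu : set (Xomega omega X) -> \bar R).
Proof.
apply/(additive2P loeb_premeasure0) => A A' bA bA'.
exact: loeb_premeasureU.
Qed.

HB.instance Definition _ := isContent.Build _ (Xomega omega X) R
  (loeb_premeasure mu) loeb_premeasure_ge0 loeb_premeasure_semi_additive.

End internal_sets.

(** * The Loeb measure of a finite internal partition *)

Section loeb_measure.
Variables (R : realType) (omega : npultrafilter) (X : nat -> pmetricType R).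
Variables (p : R) (mu : Pomega omega p X).
Local Open Scope ereal_scope.

Let pre : {content set (Xomega omega X) -> \bar R} := loeb_premeasure mu.
Let outer : {outer_measure set (Xomega omega X) -> \bar R} := loeb mu.

(** A cover of a set by internal sets splits along [A] into covers of its two
    parts, without changing the sum of the premeasures. *)
Lemma internal_loeb_measurable A : internal_borel A -> loeb_measurable mu A.
Proof.
move=> bA; apply: (@le_caratheodory_measurable R _ outer) => Z.
apply: le_ereal_inf_tmp => _ [B [mB ZB] <-].
have mBA n : measurable (B n `&` A) by exact: measurableI.
have mBCA n : measurable (B n `&` ~` A) by apply: measurableI => //; exact: measurableC.
rewrite (eq_eseriesr (g := fun n => pre (B n `&` A) + pre (B n `&` ~` A))); last first.
  move=> n _; rewrite -[LHS]/(pre (B n)) -[X in pre X](setIT (B n)) -(setUv A) setIUr.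
  by apply: measureU => //; rewrite setIACA setICr setI0.
rewrite nneseriesD//.
by apply: leeD; apply: ereal_inf_lbound; [exists (fun n => B n `&` A)|
  exists (fun n => B n `&` ~` A)] => //; split => // t [/ZB[n _ Bn] At];
  exists n.
Qed.

Lemma loeb_le_premeasure A V : internal_borel V -> A `<=` V ->
  loeb mu A <= loeb_premeasure mu V.
Proof.
move=> bV AV; apply: ereal_inf_lbound.
exists (fun n => if n is 0%N then V else set0).
  split=> [[|n]|t /AV Vt]; [exact: bV|exact: measurable0|by exists 0%N].
rewrite nneseries_recl//= ?eseries0 ?adde0//.
by move=> [|n] //= _ _; exact: loeb_premeasure0.
Qed.

Lemma stX_preimageP (x : Xlim omega X) (B : set (hatX omega X)) :
  stX_preimage B (sval x) <-> B (stX x).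
Proof.
split; last by exists x.
case: x => x hx; move=> [[y hy] By /= yx]; move: hx; rewrite -yx => hx.
by rewrite (Prop_irrelevance hx hy).
Qed.

Lemma loeb_premeasureT : loeb_premeasure mu setT = 1.
Proof.
have -> : [set: Xomega omega X] = internal (fun i => setT).
  by apply/seteqP; split => x // _; exact: filterE.
rewrite loeb_premeasureE; last by move=> i; exact: measurableT.
congr EFin; apply: hst_eq => eps eps0; apply: filterE => i /=.
by rewrite [fine _](_ : _ = 1%R) ?subrr ?normr0// probability_setT.
Qed.

Section cells.
Variables (n : nat) (V : nat -> set (Xomega omega X)).
Variable rho : probability (borel (hatX omega X)) R.
Hypothesis push_defined : loeb_push_defined mu.
Hypothesis push_rho : forall B : set (borel (hatX omega X)), measurable B ->
  rho B = loeb_push mu B.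
Hypothesis bV : forall j, internal_borel (V j).
Hypothesis tV : trivIset setT V.
Hypothesis cV : \bigcup_(j < n.+1) V j = setT.

Let T := caratheodory_type outer.
Let L : {measure set T -> \bar R} := outer.

Let mst (B : set (borel (hatX omega X))) : measurable B ->
  measurable (stX_preimage B : set T).
Proof. exact: push_defined. Qed.

Let mV j : measurable (V j : set T).
Proof. exact: internal_loeb_measurable. Qed.

Let infinite_part : set T := ~` stX_preimage setT.

Let infinite_part0 : L infinite_part = 0.
Proof.
have LS : L (stX_preimage setT) = 1.
  by rewrite -(probability_setT rho) push_rho.
have : L setT <= 1.
  rewrite -loeb_premeasureT; apply: loeb_le_premeasure => //.
  exact: (@measurableT _ (Xomega omega X)).
have mS := mst measurableT.
rewrite -(setUv (stX_preimage setT)) measureU//; last 2 first.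
- exact: measurableC.
- exact: setICr.
rewrite [X in X + _]LS -[leRHS]adde0 leeD2lE// => h.
by apply/eqP; rewrite eq_le measure_ge0 andbT.
Qed.

(* The standard part, extended by a constant to the infinite points, which form
   a null set. *)
Let st_total (x : T) : borel (hatX omega X) :=
  match pselect (exists y : Xlim omega X, sval y = x) with
  | left h => stX (sval (cid h))
  | right _ => point
  end.

Let st_total_preimage (B : set (borel (hatX omega X))) :
  st_total @^-1` B = stX_preimage B `|` (infinite_part `&` [set _ | B point]).
Proof.
apply/seteqP; split => x; rewrite /st_total /=.
  case: pselect => [h|h] Bx; [left|right].
    by case: cid Bx => y /= <- By; exact/stX_preimageP.
  by split => // -[y _ yx]; apply: h; exists y.
case: pselect => [h|h].
  case: cid => y /= yx [|[nx _]]; first by rewrite -yx => /stX_preimageP.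
  by exfalso; apply: nx; rewrite -yx; exact/stX_preimageP.
by case=> [[y _ yx]|[]] //; exfalso; apply: h; exists y.
Qed.

Let mst_total : measurable_fun setT st_total.
Proof.
move=> _ B mB; rewrite setTI st_total_preimage.
apply: measurableU; first exact: mst.
apply: measurableI; first exact/measurableC/mst.
exact: measurable_propset.
Qed.

(** [m j] is the image in the limit space of the Loeb measure restricted to
    [V j].  The Loeb measure of [V j] is its premeasure: it is at most that, and
    both families of numbers have sum 1, as [rho] is a probability measure. *)
Lemma loeb_cells : exists m : nat -> {measure set (borel (hatX omega X)) -> \bar R},
  [/\ forall B : set (borel (hatX omega X)), measurable B ->
        rho B = \sum_(j < n.+1) m j B,
      forall j, (j < n.+1)%N -> m j setT = loeb_premeasure mu (V j) &
      forall j (B : set (borel (hatX omega X))), measurable B ->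
        m j B = loeb mu (V j `&` stX_preimage B)].
Proof.
pose m j : {measure set (borel (hatX omega X)) -> \bar R} :=
  mimage (mrestr L (mV j)) mst_total.
have mE j (B : set (borel (hatX omega X))) : measurable B ->
    m j B = loeb mu (V j `&` stX_preimage B).
  move=> mB; rewrite -[LHS]/(L (st_total @^-1` B `&` V j)) st_total_preimage.
  apply/eqP; rewrite eq_le; apply/andP; split; last first.
    by apply: (le_outer_measure outer) => x [Vx Bx]; split => //; left.
  rewrite -[leRHS]adde0 -infinite_part0.
  apply: le_trans (outer_measureU2 outer _ _).
  apply: (le_outer_measure outer) => x [[Bx|[Nx _]] Vx]; [by left|by right].
have sum_m (B : set (borel (hatX omega X))) : measurable B ->
    rho B = \sum_(j < n.+1) m j B.
  move=> mB; rewrite push_rho//.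
  have mVB k : measurable (V k `&` stX_preimage B : set T).
    by apply: measurableI => //; exact: mst.
  have UE : \big[setU/set0]_(j < n.+1) (V j `&` stX_preimage B) = stX_preimage B.
    rewrite -(bigcup_mkord n.+1 (fun j => V j `&` stX_preimage B)).
    by rewrite -setI_bigcupl cV setTI.
  rewrite /loeb_push -[in LHS]UE.
  rewrite (eq_bigr (fun j : 'I_n.+1 => L (V j `&` stX_preimage B))); last first.
    by move=> j _; rewrite mE.
  have tVB : trivIset setT (fun k => V k `&` stX_preimage B : set T).
    exact: trivIset_setIr.
  apply: (@measure_semi_additive _ _ _ L (fun k => V k `&` stX_preimage B : set T)
    n.+1 mVB tVB).
  by apply: bigsetU_measurable => k _; exact: mVB.
exists m; split => // j jn.
have m_le i : m i setT <= loeb_premeasure mu (V i).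
  by rewrite mE//; apply: loeb_le_premeasure => // x [].
have sum_pre : \sum_(i < n.+1) loeb_premeasure mu (V i) = 1.
  have bVU : internal_borel (\big[setU/set0]_(i < n.+1) V i).
    by apply: (@bigsetU_measurable _ (Xomega omega X)) => k _; exact: bV.
  rewrite -loeb_premeasureT -cV bigcup_mkord.
  by rewrite (@measure_semi_additive _ _ _ pre V n.+1 bV tV bVU).
have := sum_m _ measurableT; rewrite probability_setT -sum_pre.
rewrite (bigD1 (Ordinal jn))//= [in RHS](bigD1 (Ordinal jn))//=.
move=> E; apply/eqP; rewrite eq_le m_le/= leNgt; apply/negP => mj.
have : m j setT + \sum_(i < n.+1 | i != Ordinal jn) m i setT <
   loeb_premeasure mu (V j) +
   \sum_(i < n.+1 | i != Ordinal jn) loeb_premeasure mu (V i).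
  apply: lte_leD => //.
    apply/sum_fin_numP => i _ _; rewrite ge0_fin_numE//.
    by rewrite (le_lt_trans (m_le i))// ltry.
  by apply: lee_sum => i _.
by rewrite E ltxx.
Qed.

End cells.
End loeb_measure.

(** * Uniqueness of the limit of empirical measures *)

Section ultralimit_of_wasserstein.
Variables (R : realType) (omega : npultrafilter) (p : R) (hp : 1 <= p).
Variable X : nat -> pmetricType R.
Implicit Types a b c : Plim omega p X.

Let W i := @Wp R p (X i).

Lemma Wp_eql (Y : pmetricType R) (mu mu' nu : Pp p Y) :
  (forall B, sval mu B = sval mu' B) -> Wp mu nu = Wp mu' nu.
Proof.
move=> E; rewrite /Wp; congr (fine (ereal_inf (image _ _))).
apply/seteqP; split => g gP B mB; have [g1 g2] := gP B mB; split => //.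
  by rewrite g1 E.
by rewrite g1 -E.
Qed.

Lemma Wp_diracE (Y : pmetricType R) (y : Y) (nu : Pp p Y) :
  Wp (dirac_Pp p y) nu = Wp (empirical_Pp p 0 (fun=> y)) nu.
Proof.
by apply: Wp_eql => B /=; rewrite empiricalE big_ord1 invr1 mul1e.
Qed.

Lemma Wp_triangle_near (Y : pmetricType R) N (x : nat -> Y) (mu nu la : Pp p Y) :
  Wp nu la <= Wp (empirical_Pp p N x) mu + Wp mu nu + Wp (empirical_Pp p N x) la.
Proof.
apply: (le_trans (Wp_triangle_empirical_mid hp N x nu la)); rewrite lerD2r.
by rewrite (Wp_sym nu)//; exact: Wp_triangle_empirical_end.
Qed.

Lemma Wp_triangle_near2 (Y : pmetricType R) N M (x y : nat -> Y)
    (mu nu la : Pp p Y) :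
  Wp nu la <= Wp (empirical_Pp p M y) nu +
    (Wp (empirical_Pp p M y) (empirical_Pp p N x) +
     (Wp (empirical_Pp p N x) mu + Wp mu la)).
Proof.
apply: (le_trans (Wp_triangle_empirical_mid hp M y nu la)).
rewrite (Wp_sym nu)// lerD2l.
apply: (le_trans (Wp_triangle_empirical_end hp M y (empirical_Pp p N x) la)).
by rewrite lerD2l; exact: Wp_triangle_empirical_end.
Qed.

(** Distances in the ultralimit are finite; only then is the standard part [hst]
    close to them, being 0 by convention on infinite hyperreals. *)
Lemma Plim_dist_bounded a b : exists M, omega [set i |
  `|W (urepr (sval a) i) (urepr (sval b) i)| <= M].
Proof.
have bnd (c : Plim omega p X) : exists M, omega [set i |
    Wp (empirical_Pp p 0 (fun=> point)) (urepr (sval c) i) < M].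
  case: c => c hc /=; move: hc; rewrite -{1}(ureprK c) /udist umap2E.
  move=> /hfiniteE[M hM]; exists M; apply: filterS hM => i /=.
  by rewrite ger0_norm ?Wp_ge0// Wp_diracE.
have [M hM] := bnd a; have [M' hM'] := bnd b.
exists (M + M'); apply: filterS2 hM hM' => i /= h h'.
rewrite ger0_norm ?Wp_ge0//.
apply: (le_trans (Wp_triangle_empirical_mid hp 0 (fun=> point) _ _)).
by rewrite (Wp_sym (urepr _ _))// ltW// ltrD.
Qed.

Lemma hat_classP a b : hat_class a b <-> forall eps, 0 < eps ->
  omega [set i | W (urepr (sval a) i) (urepr (sval b) i) < eps].
Proof.
rewrite /hat_class /= /udist /umap2 /hstd; split.
  move=> /happroxE h eps /h; apply: filterS => i /=.
  by rewrite subr0 ger0_norm// Wp_ge0.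
move=> h; apply/happroxE => eps /h; apply: filterS => i /=.
by rewrite subr0 ger0_norm// Wp_ge0.
Qed.

Lemma stW_eq_near a b eps : stW a = stW b -> 0 < eps ->
  omega [set i | W (urepr (sval a) i) (urepr (sval b) i) < eps].
Proof.
move=> /(congr1 sval) /= ab; move: eps; apply/hat_classP; rewrite ab.
by apply/hat_classP => eps' eps'0; apply: filterE => i /=; rewrite /W Wp_refl.
Qed.

Lemma hat_repr_near a eps : 0 < eps -> omega [set i |
  W (urepr (sval a) i) (urepr (sval (hat_repr (stW a))) i) < eps].
Proof. by apply: stW_eq_near; rewrite [RHS]hat_reprK. Qed.

Lemma hat_dist_approx (u v : hatP omega p X) eps : 0 < eps -> omega [set i |
  `|W (urepr (sval (hat_repr u)) i) (urepr (sval (hat_repr v)) i)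
    - hat_dist u v| < eps].
Proof.
have [M hM] := Plim_dist_bounded (hat_repr u) (hat_repr v).
exact: hst_approx hM.
Qed.

Section empirical.
Variables (N : nat) (x : nat -> Xlim omega X).

Let E i : Pp p (X i) := empirical_Pp p N (fun j => urepr (sval (x j)) i).

Lemma empirical_near eps : 0 < eps -> omega [set i |
  W (E i) (urepr (sval (hat_repr (iota_empirical hp N x))) i) < eps].
Proof.
move=> /(hat_repr_near (exist _ (empirical_omega p N x)
  (empirical_omega_lim hp N x))).
by apply: filterS2 (urepr_uclass omega E) => i /= ->.
Qed.

(** [hat_dist] is read off from representatives chosen in the classes.  This and
    the next lemma translate it into distances between given representatives. *)
Lemma near_of_hat_dist u eps : hat_dist u (iota_empirical hp N x) < eps ->
  omega [set i | W (E i) (urepr (sval (hat_repr u)) i) < eps].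
Proof.
set d := hat_dist _ _ => ueps.
have epsE : eps = (eps - d) / 2 + ((eps - d) / 2 + d).
  by rewrite addrA -splitr subrK.
have e0 : 0 < (eps - d) / 2 by rewrite divr_gt0// subr_gt0.
apply: filterS2 (hat_dist_approx u (iota_empirical hp N x) e0)
  (empirical_near e0) => i /=; rewrite -/d ltr_norml => /andP[_ h1] h2.
apply: (le_lt_trans (Wp_triangle_empirical_end hp N _
  (urepr (sval (hat_repr (iota_empirical hp N x))) i) _)).
rewrite (Wp_sym (urepr (sval (hat_repr (iota_empirical hp N x))) i))//.
by rewrite epsE; apply: ltrD; [exact: h2|rewrite -ltrBlDr; exact: h1].
Qed.

Lemma hat_dist_le_of_near a eps : omega [set i | W (E i) (urepr (sval a) i) <= eps] ->
  hat_dist (stW a) (iota_empirical hp N x) <= eps.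
Proof.
move=> aeps; apply/ler_addgt0Pl => d d0.
have -> : d + eps = eps + d / 2 + d / 2 by rewrite addrC {1}(splitr d) addrA.
have e0 : 0 < d / 2 by rewrite divr_gt0.
have [M hM] := Plim_dist_bounded (hat_repr (stW a))
  (hat_repr (iota_empirical hp N x)).
apply: (hst_le hM).
apply: filterS3 aeps (hat_repr_near a e0) (empirical_near e0) => i /= h1 h2 h3.
apply: (le_trans (Wp_triangle_near N (fun j => urepr (sval (x j)) i)
  (urepr (sval a) i) _ _)).
apply: lerD; last exact: (ltW h3).
by apply: lerD; [exact: h1|exact: (ltW h2)].
Qed.

End empirical.

Lemma hatd_stX_approx (x y : Xlim omega X) eps : 0 < eps -> omega [set i |
  `|mdist (urepr (sval x) i) (urepr (sval y) i) - mdist (stX x) (stX y)| < eps].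
Proof.
move=> eps0; have e0 : 0 < eps / 3 by rewrite divr_gt0.
have near_repr (z : Xlim omega X) : omega [set i |
    mdist (urepr (sval z) i) (urepr (sval (hat_repr (stX z))) i) < eps / 3].
  have := congr1 sval (hat_reprK (stX z)) => /= zz.
  have : hat_class (hat_repr (stX z)) (hat_repr (stX z)).
    rewrite /hat_class /= /udist /umap2; apply/happroxE => d d0.
    by apply: filterE => i /=; rewrite mdistxx subr0 normr0.
  rewrite zz /hat_class /= /udist /umap2 => /happroxE/(_ _ e0).
  by apply: filterS => i /=; rewrite subr0 ger0_norm// mdist_ge0.
apply: filterS3 (near_repr x) (near_repr y) (hatd_approx (stX x) (stX y) e0).
move=> i /=; rewrite -[mdist (stX x) (stX y)]/(hatd (stX x) (stX y)).
set xi := urepr (sval x) i; set yi := urepr (sval y) i.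
set xi' := urepr _ _; set yi' := urepr _ _ => h1 h2.
have := metric_triangle xi xi' yi; have := metric_triangle xi' yi' yi.
have := metric_triangle xi' xi yi'; have := metric_triangle xi yi yi'.
rewrite (metric_sym xi' xi) (metric_sym yi' yi) !ltr_norml.
by move=> ? ? ? ? /andP[? ?]; apply/andP; split; lra.
Qed.

(** Closeness of empirical measures is witnessed by finitely many distances, so
    it passes from the limit space to almost all factors. *)
Lemma empirical_transfer N M (x y : nat -> Xlim omega X) (u v : R) : u < v ->
  Wp (empirical_Pp p N (fun j => stX (x j)))
     (empirical_Pp p M (fun j => stX (y j))) < u ->
  omega [set i | Wp (empirical_Pp p N (fun j => urepr (sval (x j)) i))
                    (empirical_Pp p M (fun j => urepr (sval (y j)) i)) <= v].
Proof.
move=> uv Wu; have u0 : 0 < u by rewrite (le_lt_trans _ Wu)// Wp_ge0.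
have vu0 : 0 < v - u by rewrite subr_gt0.
have [pi piP pic] := Wp_lt_plan hp Wu.
have [c1 [c2 [c10 c20 cE cT]]] := powR_triangle hp u0 vu0.
have close : omega [set i | forall jk : 'I_N.+1 * 'I_M.+1,
    `|mdist (urepr (sval (x jk.1)) i) (urepr (sval (y jk.2)) i) -
      mdist (stX (x jk.1)) (stX (y jk.2))| < v - u].
  apply: (@filter_forall _ _ (fun (jk : 'I_N.+1 * 'I_M.+1) i =>
    `|mdist (urepr (sval (x jk.1)) i) (urepr (sval (y jk.2)) i) -
      mdist (stX (x jk.1)) (stX (y jk.2))| < v - u)) => jk.
  exact: hatd_stX_approx.
apply: filterS close => i /= close.
apply: (Wp_le_plan hp _ piP); first by rewrite (le_trans (ltW u0))// ltW.
have -> : v = u + (v - u) by lra.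
rewrite -cE; have [pi0 row _] := piP.
apply: (@le_trans _ _ (\sum_(j < N.+1) \sum_(k < M.+1)
    (c1 * (pi j k * mdist (stX (x j)) (stX (y k)) `^ p) +
     c2 * (v - u) `^ p * pi j k))).
  apply: ler_sum => j _; apply: ler_sum => k _.
  have := close (j, k); rewrite /= ltr_norml => /andP[_ djk].
  apply: (@le_trans _ _ (pi j k * (c1 * mdist (stX (x j)) (stX (y k)) `^ p +
    c2 * (v - u) `^ p))); last by rewrite le_eqVlt; apply/orP; left; apply/eqP; ring.
  apply: ler_wpM2l => //; apply: (le_trans _ (cT _ _ (mdist_ge0 _ _) (ltW vu0))).
  apply: ge0_ler_powR; rewrite ?nnegrE ?mdist_ge0//.
  - by rewrite (le_trans _ hp).
  - by rewrite addr_ge0 ?mdist_ge0// ltW.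
  - by move: djk; lra.
under eq_bigr do rewrite big_split/= -!mulr_sumr.
rewrite big_split/= -!mulr_sumr; apply: lerD.
  by apply: ler_wpM2l => //; exact: ltW.
rewrite (eq_bigr (fun=> N.+1%:R^-1)) => [|j _]; last exact: row.
rewrite sumr_const card_ord -[X in _ * X]mulr_natl mulfV ?mulr1//.
Qed.

Section iota.
Variable rho : Pp p (hatX omega X).

(** The property by which [iota] picks the image of [rho]. *)
Definition iota_limit (u : hatP omega p X) : Prop := forall eps : R, 0 < eps ->
  exists (N : nat) (x : nat -> Xlim omega X),
    Wp rho (empirical_Pp p N (fun j => stX (x j))) < eps /\
    hat_dist u (iota_empirical hp N x) < eps.

Let iota_limit_sub u v c : iota_limit u -> iota_limit v ->
  hat_class (hat_repr u) c -> hat_class (hat_repr v) c.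
Proof.
move=> uS vS /hat_classP uc; apply/hat_classP => eps eps0.
have e0 : 0 < eps / 8 by rewrite divr_gt0.
have e84 : eps / 8 < eps / 4 by lra.
have e82 : eps / 8 + eps / 8 < eps / 2 by lra.
have epsE : eps = eps / 8 + (eps / 2 + (eps / 8 + eps / 4)) by lra.
have [N [x [rx /near_of_hat_dist ux]]] := uS _ e0.
have [M [y [ry /near_of_hat_dist vy]]] := vS _ e0.
have xy : Wp (empirical_Pp p M (fun j => stX (y j)))
             (empirical_Pp p N (fun j => stX (x j))) < eps / 8 + eps / 8.
  apply: (le_lt_trans (Wp_triangle_empirical_end hp M (fun j => stX (y j)) rho _)).
  by rewrite (Wp_sym (empirical_Pp _ _ _) rho)// ltrD.
have /(empirical_transfer _)-/(_ (eps / 2)) := xy.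
move=> /(_ e82) xyi.
apply: filterS3 (filterI ux (uc _ e0)) vy xyi => i /= [h1 h2] h3 h4.
apply: (le_lt_trans (Wp_triangle_near2 N M (fun j => urepr (sval (x j)) i)
  (fun j => urepr (sval (y j)) i) (urepr (sval (hat_repr u)) i) _ _)).
rewrite epsE; apply: ltrD; first exact: h3.
apply: ler_ltD; first exact: h4.
by apply: ltrD; [exact: h1|exact: (lt_trans h2)].
Qed.

Lemma iota_limit_unique u v : iota_limit u -> iota_limit v -> u = v.
Proof.
move=> uS vS; rewrite -(hat_reprK u) -(hat_reprK v); apply: eq_exist.
by apply/seteqP; split => c; exact: iota_limit_sub.
Qed.

Lemma iota_eq u : iota_limit u -> u = Defs.iota hp rho.
Proof.
move=> uS; apply: iota_limit_unique => //.
rewrite /Defs.iota; apply: (@xgetPex _ _ [set v | iota_limit v]).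
by exists u.
Qed.

End iota.

End ultralimit_of_wasserstein.

(** * Empirical approximation of the measure and of its standard part *)

Lemma measurable_mdist_ball (R : realType) (Y : pmetricType R) (x : Y) (r : R) :
  measurable ([set y | mdist x y < r] : set (borel Y)).
Proof.
apply: sub_sigma_algebra; have := @open_mdist_ball R Y x r.
by rewrite ballEmdist.
Qed.

(** A finite family of balls cuts the space into the points that enter the
    family at the ball [j] (label [j.+1]), and the rest (label 0). *)
Lemma ex_ball_labelling (R : realType) (Y : pmetricType R) n (x : nat -> Y)
    (r : R) : exists lab : Y -> nat, [/\ forall y, (lab y < n.+1)%N,
    forall j, measurable ([set y | lab y = j] : set (borel Y)),
    forall j y, lab y = j.+1 -> mdist (x j) y < r &
    forall y, lab y = 0%N -> forall j, (j < n)%N -> r <= mdist (x j) y].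
Proof.
elim: n => [|n [lab [lab_lt mlab labS lab0]]].
  by exists (fun=> 0%N); split => // j; exact: measurable_propset.
pose lab' y := if (lab y == 0%N) && (mdist (x n) y < r) then n.+1 else lab y.
exists lab'; split.
- by move=> y; rewrite /lab'; case: ifP => // _; rewrite (ltn_trans (lab_lt y)).
- move=> j; have mB := measurable_mdist_ball (x n) r.
  have -> : [set y | lab' y = j] =
      (([set y | lab y = 0%N] `&` [set y | mdist (x n) y < r]) `&`
        [set _ | j = n.+1]) `|`
      (~` ([set y | lab y = 0%N] `&` [set y | mdist (x n) y < r]) `&`
        [set y | lab y = j]).
    apply/seteqP; split => y; rewrite /lab' /=.
      case: ifP => [/andP[/eqP ly xy] <-|/negP ly lj]; first by left.
      by right; split => // -[l0 xy]; apply: ly; rewrite l0 eqxx.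
    case=> [[[-> ->] ->]|[ly <-]]; first by rewrite eqxx.
    by case: ifP => // /andP[/eqP ? ?]; exfalso; apply: ly.
  have mA : measurable ([set y | lab y = 0%N] `&` [set y | mdist (x n) y < r]
      : set (borel Y)).
    exact: measurableI (mlab 0%N) mB.
  apply: measurableU; last by apply: measurableI; [exact: measurableC|exact: mlab].
  by apply: measurableI => //; exact: measurable_propset.
- move=> j y; rewrite /lab'; case: ifP => [/andP[_ xy] [<-//]|_]; exact: labS.
- move=> y; rewrite /lab'; case: ifP => // /negbT.
  rewrite negb_and -leNgt => + l0; rewrite l0 eqxx/= => xy j.
  by rewrite ltnS leq_eqVlt => /predU1P[->//|]; exact: lab0.
Qed.

Section approximation.
Variables (R : realType) (omega : npultrafilter) (p : R) (hp : 1 <= p).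
Variables (X : nat -> pmetricType R) (mu : Plim omega p X) (D : R).
Hypothesis mu_supp :
  internal_measure (sval mu) (~` uball (omega := omega) (X := X) D) =
    hstd omega 0.
Hypothesis push_defined : loeb_push_defined (sval mu).
Variable rho : Pp p (hatX omega X).
Hypothesis push_rho : forall B : set (borel (hatX omega X)), measurable B ->
  sval rho B = loeb_push (sval mu) B.

Let mu_ i : probability (borel (X i)) R := sval (urepr (sval mu) i).

Let center : Xlim omega X := exist _ (uclass omega (fun=> point)) (Xlim_center omega X).

Let center_ : omega [set i | urepr (sval center) i = point].
Proof. exact: urepr_uclass. Qed.

Let farE : ~` uball (omega := omega) (X := X) D =
  internal (fun i => [set y | ~ (mdist (point : X i) y < D)]).
Proof.
have uballP (x : Xomega omega X) : uball D x <->
    omega [set i | mdist (point : X i) (urepr x i) < D].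
  by rewrite /uball /= -{1}(ureprK x) /udist umap2E; exact: hltE.
apply/seteqP; split => x /=.
  move=> nx; have [h|//] := in_ultra_setVsetC
    [set i | mdist (point : X i) (urepr x i) < D] (ufilter_ultra omega).
  by exfalso; apply: nx; apply/uballP.
move=> h /uballP h'.
by have [i []] := filter_ex (filterI h h').
Qed.

Let bfar : borel_family (fun i => [set y : X i | ~ (mdist (point : X i) y < D)]).
Proof. by move=> i; apply: measurableC; exact: measurable_mdist_ball. Qed.

Let far0 : omega [set i | mu_ i [set y | ~ (mdist point y < D)] = 0%E].
Proof.
move: mu_supp; rewrite farE internal_measureE// => /uclassP.
apply: filterS => i /= /eqP; rewrite fine_eq0; first by move/eqP.
by apply: fin_num_measure; exact: bfar.
Qed.

Let loeb_far0 : loeb_premeasure (sval mu) (~` uball (omega := omega) (X := X) D) = 0%E.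
Proof.
rewrite /loeb_premeasure mu_supp; congr EFin; apply: hst_eq => eps eps0.
by apply: filterE => i /=; rewrite subrr normr0.
Qed.

(** Balls of radius [r] around finitely many points of the limit space, and around
    their representatives in the factors, cut out corresponding cells of nearly
    equal masses, so one choice of points and labels serves [rho] and [mu]. *)
Lemma ex_empirical_near (eps : R) : 0 < eps ->
  exists N (x : nat -> Xlim omega X),
    Wp rho (empirical_Pp p N (fun j => stX (x j))) <= eps /\
    omega [set i | Wp (empirical_Pp p N (fun j => urepr (sval (x j)) i))
                      (urepr (sval mu) i) <= eps].
Proof.
move=> eps0; have p0 : 0 < p by rewrite (lt_le_trans _ hp).
(* The radius [r] and the admissible excess mass [d], moved over a distance at
   most [D1], each take half of the budget [eps `^ p]. *)
pose D1 := Num.max D 1; have D10 : 0 < D1 by rewrite lt_max ltr01 orbT.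
have DD1 : D <= D1 by rewrite le_max lexx.
have ep0 : 0 < eps `^ p by exact: powR_gt0.
have Dp0 : 0 < D1 `^ p by exact: powR_gt0.
pose r := (eps `^ p / 2) `^ p^-1.
have r0 : 0 < r by rewrite powR_gt0// divr_gt0.
have rp : r `^ p = eps `^ p / 2.
  by rewrite -powRrM mulVf ?gt_eqF// powRr1// divr_ge0// ltW.
pose d := eps `^ p / 2 / D1 `^ p.
have d0 : 0 < d by rewrite !divr_gt0.
have budget : r `^ p + D1 `^ p * d <= eps `^ p.
  by rewrite rp /d [X in _ + X]mulrC divfK ?gt_eqF// -splitr.
have d20 : 0 < d / 2 by rewrite divr_gt0.
have [K cK rhoK] : exists2 K : set (hatX omega X), compact K &
    ((1 - d / 2)%:E < sval rho K)%E.
  have : ((1 - d / 2)%:E < sval rho setT)%E.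
    by rewrite probability_setT lte_fin ltrBlDr ltrDl.
  rewrite ((svalP rho).1 _ measurableT) => /ereal_sup_gt[_ [K [cK _] <-] ?].
  by exists K.
have mK : measurable (K : set (borel (hatX omega X))) by exact: compact_borel.
have [s sK] := compact_net cK r0.
pose n := size s.
pose xx j : Xlim omega X := if j is k.+1 then hat_repr (nth point s k) else center.
have stxx k : stX (xx k.+1) = nth point s k by exact: hat_reprK.
pose labelling i := cid (ex_ball_labelling n (fun k => urepr (sval (xx k.+1)) i) r).
pose lab i := sval (labelling i).
have lab_lt i y : (lab i y < n.+1)%N by have [+ _ _ _] := svalP (labelling i); apply.
have mlab i j : measurable ([set y | lab i y = j] : set (borel (X i))).
  by have [_ + _ _] := svalP (labelling i); apply.
have labS i j y : lab i y = j.+1 -> mdist (urepr (sval (xx j.+1)) i) y < r.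
  by have [_ _ + _] := svalP (labelling i); apply.
have lab0 i y : lab i y = 0%N -> forall j, (j < n)%N ->
    r <= mdist (urepr (sval (xx j.+1)) i) y.
  by have [_ _ _] := svalP (labelling i); apply.
pose V j : set (Xomega omega X) := internal (fun i => [set y | lab i y = j]).
have bV j : internal_borel (V j).
  by exists (fun i => [set y | lab i y = j]) => // i; exact: mlab.
have tV : trivIset setT V.
  move=> j k _ _ [z [/= zj zk]].
  by have [i /= [<- <-]] := filter_ex (filterI zj zk).
have cV : \bigcup_(j < n.+1) V j = setT.
  apply/seteqP; split => // z _; apply: contrapT => nz.
  have nV (j : 'I_n.+1) : omega [set i | lab i (urepr z i) <> j].
    have [h|//] := in_ultra_setVsetC [set i | lab i (urepr z i) = j]
      (ufilter_ultra omega).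
    by exfalso; apply: nz; exists j => /=.
  have nV' : omega [set i | forall j : 'I_n.+1, lab i (urepr z i) <> j].
    by apply: (@filter_forall _ _ (fun (j : 'I_n.+1) i => lab i (urepr z i) <> j)).
  have [i /= iV] := filter_ex nV'.
  exact: (iV (Ordinal (lab_lt i (urepr z i)))).
have [m [rhoE mT mE]] := loeb_cells push_defined push_rho bV tV cV.
pose w j := hst (uclass omega (fun i => fine (mu_ i [set y | lab i y = j]))).
have blab j : borel_family (fun i => [set y : X i | lab i y = j]).
  by move=> i; exact: mlab.
have wE j : loeb_premeasure (sval mu) (V j) = (w j)%:E by exact: loeb_premeasureE.
have w0 j : 0 <= w j.
  by rewrite -lee_fin -wE; exact: loeb_premeasure_ge0.
have w1 : \sum_(j < n.+1) w j = 1.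
  apply: EFin_inj; rewrite -sumEFin -(probability_setT (sval rho)) rhoE//.
  by apply: eq_bigr => j _; rewrite mT// wE.
have hatd_lt (y : Xlim omega X) j (u v : R) : mdist (stX (xx j)) (stX y) < u ->
    omega [set i | mdist (urepr (sval (xx j)) i) (urepr (sval y) i) < u].
  move=> yu; have e0 : 0 < u - mdist (stX (xx j)) (stX y) by rewrite subr_gt0.
  apply: filterS (hatd_stX_approx (xx j) y e0) => i /=.
  by rewrite ltr_norml => /andP[_]; rewrite ltrD2r.
have hatd_gt (y : Xlim omega X) j (u : R) : u < mdist (stX (xx j)) (stX y) ->
    omega [set i | u < mdist (urepr (sval (xx j)) i) (urepr (sval y) i)].
  move=> yu; have e0 : 0 < mdist (stX (xx j)) (stX y) - u by rewrite subr_gt0.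
  apply: filterS (hatd_stX_approx (xx j) y e0) => i /=.
  by rewrite ltr_norml => /andP[+ _]; rewrite opprB ltrD2r.
have w0d : w 0%N <= d / 2.
  rewrite -lee_fin -wE -mT// -(setUv K) measureU//; last 2 first.
  - exact: measurableC.
  - exact: setICr.
  (* A point near [K] lies in some ball, hence not in the remaining cell. *)
  have m0K : m 0%N K = 0%E.
    rewrite mE// (_ : _ `&` _ = set0); first exact: outer_measure0.
    apply/seteqP; split => // z [V0 [y Ky yz]].
    move: V0; rewrite -yz => V0.
    have [x xs xy] := sK _ Ky.
    have jn : (index x s < n)%N by rewrite index_mem.
    have := hatd_lt y (index x s).+1 r r; rewrite stxx nth_index// => /(_ xy) h.
    have [i /= [h1 h2]] := filter_ex (filterI V0 h).
    by have := lab0 _ _ h1 _ jn; rewrite leNgt h2.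
  rewrite [X in (X + _ <= _)%E]m0K add0e.
  apply: (@le_trans _ _ (sval rho (~` K))).
    rewrite rhoE; last exact: measurableC.
    by rewrite big_ord_recl leeDl// sume_ge0.
  rewrite probability_setC//; move: rhoK.
  have : sval rho K \is a fin_num by exact: fin_num_measure.
  case: (sval rho K) => // k _; rewrite lte_fin -EFinB lee_fin => rhoK.
  by rewrite lerBlDr -lerBlDl ltW.
have [N [l [l_lt l_w l_0]]] := ex_labels d20 w0 w1.
have l_d : freq R N l 0 <= d by rewrite (le_trans l_0)// [leRHS]splitr lerD2r.
exists N, (fun k => xx (l k)); split.
  rewrite Wp_sym//.
  apply: (@Wp_le_cells R p _ hp rho n m (fun j => stX (xx j)) N l r D1 d eps) => //.
  - move=> j jn; rewrite mE; last exact: measurable_mdist_gt.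
    apply/eqP; rewrite eq_le outer_measure_ge0 andbT -loeb_far0.
    apply: loeb_le_premeasure.
      rewrite farE.
      by exists (fun i => [set y : X i | ~ (mdist (point : X i) y < D)]).
    move=> z; rewrite farE => -[_ [y /= yD <-]]; rewrite /internal /=.
    have h := hatd_gt y 0%N D1 yD.
    apply: filterS2 center_ h => i /= -> Di.
    by apply/negP; rewrite -leNgt (le_trans DD1)// ltW.
  - move=> [|j] // jn; rewrite mE; last exact: measurable_mdist_gt.
    rewrite (_ : _ `&` _ = set0) ?outer_measure0//.
    apply/seteqP; split => // z [Vj [y /= yr yz]].
    move: Vj; rewrite -yz => Vj.
    have h := hatd_gt y j.+1 r yr.
    have [i /= [h1 h2]] := filter_ex (filterI Vj h).
    by have := lt_trans h2 (labS _ _ _ h1); rewrite ltxx.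
  - move=> j jn; have jn' : (j < n.+1)%N by case/andP: jn.
    rewrite mT// wE lee_fin; have [->|/ltW//] := l_w j jn.
    exact: w0.
  - exact: ltW.
have close : omega [set i | forall j : 'I_n.+1, (0 < j)%N ->
    freq R N l j <= fine (mu_ i [set y | lab i y = j])].
  apply: (@filter_forall _ _ (fun (j : 'I_n.+1) i => (0 < j)%N ->
    freq R N l j <= fine (mu_ i [set y | lab i y = j]))) => j.
  have [j0|j0] := posnP j; first by apply: filterE => i; rewrite j0.
  have jn : (0 < j < n.+1)%N by rewrite j0/=.
  have [->|lw] := l_w j jn; first by apply: filterE => i _; exact: fine_ge0.
  have e0 : 0 < w j - freq R N l j by rewrite subr_gt0.
  have := hst_approx (internal_bounded (sval mu) (blab j)) e0.
  apply: filterS => i /=; rewrite ltr_norml => /andP[+ _] _.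
  by rewrite opprB ltrD2r => /ltW.
apply: filterS3 close far0 center_ => i /= close far ci.
apply: (@Wp_le_cells R p _ hp (urepr (sval mu) i) n
  (fun j => mrestr (mu_ i) (mlab i j)) (fun j => urepr (sval (xx j)) i)
  N l r D1 d eps) => //.
- move=> B mB.
  have BE : B = \big[setU/set0]_(j < n.+1) (B `&` [set y | lab i y = j]).
    rewrite -(bigcup_mkord n.+1 (fun j => B `&` [set y | lab i y = j])).
    rewrite -setI_bigcupr [X in _ `&` X](_ : _ = setT) ?setIT//.
    by apply/seteqP; split => // y _; exists (lab i y) => //=.
  rewrite [in LHS]BE (@measure_semi_additive _ _ _ (mu_ i)
    (fun j => B `&` [set y | lab i y = j]) n.+1)//.
  + by move=> j; apply: measurableI => //; exact: mlab.
  + by move=> j k _ _ [y [/= [_ <-] [_ <-]]].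
  + by apply: bigsetU_measurable => j _; apply: measurableI => //; exact: mlab.
- move=> j jn; rewrite /= /mrestr; apply/eqP; rewrite eq_le measure_ge0 andbT.
  rewrite -far; apply: le_measure; rewrite ?inE.
  + by apply: measurableI; [exact: measurable_mdist_gt|exact: mlab].
  + exact: bfar.
  + move=> y [/= + _]; rewrite ci => Dy.
    by apply/negP; rewrite -leNgt (le_trans DD1)// ltW.
- move=> [|j] // jn; rewrite /= /mrestr -(measure0 (mu_ i)); congr (mu_ i _).
  apply/seteqP; split => // y [/= h1 h2].
  by have := lt_trans h1 (labS _ _ _ h2); rewrite ltxx.
- move=> j /andP[j0 jn]; rewrite /= /mrestr setTI.
  have := close (Ordinal jn) j0; rewrite -lee_fin fineK//.
  by apply: fin_num_measure; exact: mlab.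
- exact: ltW.
Qed.

End approximation.

Theorem lemma27 (R : realType) (omega : npultrafilter) (p : R) (hp : 1 <= p)
  (X : nat -> pmetricType R) (mu : Plim omega p X) (D : R)
  (mu_supp :
    internal_measure (sval mu) (~` uball (omega := omega) (X := X) D) =
      hstd omega 0)
  (push_defined : loeb_push_defined (sval mu))
  (rho : Pp p (hatX omega X))
  (push_rho : forall B : set (borel (hatX omega X)), measurable B ->
    sval rho B = loeb_push (sval mu) B) :
  is_lifting hp mu rho.
Proof.
apply: iota_eq => eps eps0; have e0 : 0 < eps / 2 by rewrite divr_gt0.
have e2 : eps / 2 < eps by rewrite ltr_pdivrMr// ltr_pMr// ltr1n.
have [N [x [rhox mux]]] := ex_empirical_near hp mu_supp push_defined push_rho e0.
exists N, x; split; first exact: le_lt_trans rhox e2.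
exact: le_lt_trans (hat_dist_le_of_near hp mux) e2.
Qed.
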